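(* Let $\Gamma\rightrightarrows\Gamma^{(0)}$ be a symplectic groupoid with range and source maps $r_\Gamma,s_\Gamma$ and inversion $i_\Gamma$, and let $\Lambda$ be a Lagrangian submanifold of $\Gamma$. Then $\Lambda$ is locally invertible (resp. invertible) if and only if the maps $$ r_\Gamma:\Lambda\longrightarrow\Gamma^{(0)}\quad\text{and}\quad s_\Gamma:\Lambda\longrightarrow\Gamma^{(0)}$$ are local diffeomorphisms (resp. diffeomorphisms onto their ranges). In that case, $\Lambda$ is transversally convolable with $\Lambda^\star=i_\Gamma(\Lambda)$, and $\Lambda^\star$ is a local inverse (resp. an inverse) of $\Lambda$.
   Context: All manifolds are $C^\infty$, $\sigma$-compact, with connected components of the same dimension. A symplectic groupoid is a Lie groupoid $\Gamma\rightrightarrows\Gamma^{(0)}$ with multiplication $m_\Gamma:\Gamma^{(2)}=\{(\gamma_1,\gamma_2):s_\Gamma(\gamma_1)=r_\Gamma(\gamma_2)\}\to\Gamma$, endowed with a symplectic form such that the graph $\{(\gamma_1,\gamma_2,\gamma):\gamma=\gamma_1\gamma_2\}$ of $m_\Gamma$ is a Lagrangian submanifold of $\Gamma\times\Gamma\times(-\Gamma)$. A local submanifold of dimension $p$ is a countable union of submanifolds of dimension $p$; a patch of a local submanifold $Z$ is a submanifold contained in $Z$ and of the same dimension as $Z$. Two submanifolds $Z_1,Z_2$ of a manifold intersect cleanly if $Z_1\cap Z_2$ is a submanifold and $T_z(Z_1\cap Z_2)=T_zZ_1\cap T_zZ_2$ at all its points (with the excess $e=\operatorname{codim}(T_zZ_1+T_zZ_2)$);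 the intersection is transversal if $e=0$. For local submanifolds, a clean (resp. transversal) intersection means that there are countable covers by patches $Z_{1j}$, $Z_{2k}$ such that all $Z_{1j}\cap Z_{2k}$ are clean with the same excess (resp. transversal). Two Lagrangian (local) submanifolds $\Lambda_1,\Lambda_2$ of $\Gamma$ are cleanly (resp. transversally) convolable if $\Lambda_1\times\Lambda_2$ intersects $\Gamma^{(2)}$ cleanly (resp. transversally) in $\Gamma^2$; then $\Lambda_1.\Lambda_2:=m_\Gamma\big((\Lambda_1\times\Lambda_2)\cap\Gamma^{(2)}\big)$, which is a Lagrangian local submanifold of $\Gamma$. A Lagrangian submanifold $\Lambda\subset\Gamma$ is invertible if there is a Lagrangian submanifold $\Lambda'\subset\Gamma$, cleanly convolable with $\Lambda$ (in both orders, so that both products below make sense), such that $\Lambda.\Lambda'=r_\Gamma(\Lambda)$ and $\Lambda'.\Lambda=s_\Gamma(\Lambda)$; such a $\Lambda'$ is called an inverse of $\Lambda$. A Lagrangian local submanifold is locally invertible if it can be covered by invertible patches, and any Lagrangian local submanifold made of inverses of the corresponding invertible patches is called a local inverse of it. *)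

(* Defs.v *)
From HB Require Import structures.
From mathcomp Require Import all_boot all_order all_algebra.
From mathcomp Require Import all_classical all_reals all_analysis.

Set Implicit Arguments.
Unset Strict Implicit.
Unset Printing Implicit Defensive.

Import Order.TTheory GRing.Theory Num.Theory.
Import numFieldNormedType.Exports.

Local Open Scope classical_set_scope.
Local Open Scope ring_scope.

Section Smooth.
Context {R : realType}.

(* f is of class C^k on U; only meant for open U. *)
Fixpoint Ck (k : nat) (V W : normedModType R) (U : set V) (f : V -> W) : Prop :=
  if k is k'.+1 then
    (forall x, U x -> differentiable f x) /\
    (forall v, Ck k' U (fun x => 'D_v f x))
  else forall x, U x -> {for x, continuous f}.

Definition smooth_on (V W : normedModType R) (U : set V) (f : V -> W) :=
  forall k, Ck k U f.

Lemma near_eq_continuous (T T' : topologicalType) (f g : T -> T') (x : T) :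
  (\near x, f x = g x) -> {for x, continuous f} -> {for x, continuous g}.
Proof.
move=> fg fc; rewrite /prop_for /continuous_at -(nbhs_singleton fg).
by apply: cvg_trans fc; apply: near_eq_cvg.
Qed.

Lemma near_eq_differentiable (V W : normedModType R) (f g : V -> W) (x : V) :
  (\near x, f x = g x) -> differentiable f x -> differentiable g x.
Proof.
move=> fg df; have fgx := nbhs_singleton fg.
have /diff_locallyP [dfc dfE] := df.
have gE : g \o shift x = cst (g x) + 'd f x +o_ 0 id.
  apply/eqaddoP => e e0; move/eqaddoP : dfE => /(_ e e0).
  have fg0 : \forall y \near 0, f (y + x) = g (y + x).
    by move: fg; rewrite (near_shift 0 x); apply: filterS => y /=; rewrite subr0.
  by apply: filterS2 fg0 => y /= fgy; rewrite !fctE /= fgx fgy.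
apply/diff_locallyP; rewrite (diff_unique dfc gE); split => //.
Qed.

Lemma row_mx_continuous (T : topologicalType) m n (f : T -> 'rV[R]_m)
    (g : T -> 'rV[R]_n) (x : T) :
  {for x, continuous f} -> {for x, continuous g} ->
  {for x, continuous (fun y => row_mx (f y) (g y))}.
Proof.
move=> fc gc A /nbhs_ballP[e /= e0 eA].
have fn : \forall y \near x, ball (f x) e (f y) := fc _ (nbhsx_ballx _ _ e0).
have gn : \forall y \near x, ball (g x) e (g y) := gc _ (nbhsx_ballx _ _ e0).
rewrite !near_simpl /=; apply: filterS2 gn fn => y /= [_ gy] [_ fy]; apply: eA; split => // i j.
by rewrite !mxE; case: splitP => k _; [exact: fy|exact: gy].
Qed.

Lemma diff_comp_lin (V W W' : normedModType R) (L : {linear W -> W'})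
    (f : V -> W) (x : V) :
  continuous L -> differentiable f x ->
  differentiable (L \o f) x /\ forall v, 'd (L \o f) x v = L ('d f x v).
Proof.
move=> Lc df; have dL := @linear_differentiable _ _ _ L (f x) Lc.
split=> [|v]; first exact: differentiable_comp.
by rewrite (diff_comp df dL) (diff_lin _ Lc).
Qed.

Lemma row_mx_differentiable (V : normedModType R) m n (f : V -> 'rV[R]_m)
    (g : V -> 'rV[R]_n) (x : V) :
  differentiable f x -> differentiable g x ->
  differentiable (fun y => row_mx (f y) (g y)) x /\
  forall v, 'd (fun y => row_mx (f y) (g y)) x v = row_mx ('d f x v) ('d g x v).
Proof.
move=> df dg.
pose L : 'rV[R]_m -> 'rV[R]_(m + n) := fun a => row_mx a 0.
pose M : 'rV[R]_n -> 'rV[R]_(m + n) := fun a => row_mx 0 a.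
have Llin : linear L.
  by move=> a u v; rewrite /L scale_row_mx add_row_mx scaler0 addr0.
have Mlin : linear M.
  by move=> a u v; rewrite /M scale_row_mx add_row_mx scaler0 addr0.
pose LL : {linear _ -> _} := HB.pack L (GRing.isLinear.Build _ _ _ _ _ Llin).
pose MM : {linear _ -> _} := HB.pack M (GRing.isLinear.Build _ _ _ _ _ Mlin).
have Lc : continuous LL.
  move=> u; apply: (@row_mx_continuous _ m n id (cst 0) u).
    by move=> /= A.
  by exact: cst_continuous.
have Mc : continuous MM.
  move=> u; apply: (@row_mx_continuous _ m n (cst 0) id u).
    by exact: cst_continuous.
  by move=> /= A.
have LE a : LL a = row_mx a 0 by [].
have ME a : MM a = row_mx 0 a by [].
clearbody LL MM; clear Llin Mlin L M.
have [dL dLE] := diff_comp_lin Lc df; have [dM dME] := diff_comp_lin Mc dg.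
have addE (W : zmodType) (A B : V -> W) v : (A \+ B) v = A v + B v by [].
have -> : (fun y => row_mx (f y) (g y)) = (LL \o f) + (MM \o g).
  by apply/funext => y; rewrite fctE /= LE ME add_row_mx addr0 add0r.
split=> [|v]; first exact: differentiableD.
rewrite (diffD dL dM) addE.
apply: etrans (congr2 +%R (dLE v) (dME v)) _.
by rewrite LE ME add_row_mx addr0 add0r.
Qed.

Lemma Ck_prod k m1 n1 m2 n2 (U : set 'rV[R]_(m1 + m2))
    (U1 : set 'rV[R]_m1) (U2 : set 'rV[R]_m2)
    (f : 'rV[R]_m1 -> 'rV[R]_n1) (g : 'rV[R]_m2 -> 'rV[R]_n2) h :
  open U -> (forall u, U u -> U1 (lsubmx u) /\ U2 (rsubmx u)) ->
  Ck k U1 f -> Ck k U2 g ->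
  (forall u, U u -> h u = row_mx (f (lsubmx u)) (g (rsubmx u))) -> Ck k U h.
Proof.
move=> oU UU; elim: k f g h => [|k IH] f g h /=.
  move=> fc gc hE x Ux; have [U1x U2x] := UU _ Ux.
  pose H := fun u : 'rV[R]_(m1 + m2) => row_mx (f (lsubmx u)) (g (rsubmx u)).
  have Hc : {for x, continuous H}.
    apply: row_mx_continuous; apply: continuous_comp; try exact: fc;
      try exact: gc; [exact: continuous_lsubmx|exact: continuous_rsubmx].
  have HE : \near x, H x = h x.
    by apply: filterS (open_nbhs_nbhs (conj oU Ux)) => u /hE.
  exact: near_eq_continuous HE Hc.
move=> [fd fD] [gd gD] hE.
pose H := fun u : 'rV[R]_(m1 + m2) => row_mx (f (lsubmx u)) (g (rsubmx u)).
have HE x : U x -> \near x, H x = h x.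
  by move=> Ux; apply: filterS (open_nbhs_nbhs (conj oU Ux)) => u /hE.
have dH x : U x -> differentiable H x /\ forall v, 'd H x v =
    row_mx ('d f (lsubmx x) (lsubmx v)) ('d g (rsubmx x) (rsubmx v)).
  move=> Ux; have [U1x U2x] := UU _ Ux.
  have dl := @differentiable_lsubmx R 1 m1 m2 x.
  have dr := @differentiable_rsubmx R 1 m1 m2 x.
  have dfl := differentiable_comp dl (fd _ U1x).
  have dgr := differentiable_comp dr (gd _ U2x).
  have [dHx dHE] := row_mx_differentiable dfl dgr.
  split=> // v; rewrite dHE (diff_comp dl (fd _ U1x)) (diff_comp dr (gd _ U2x)).
  have -> : 'd (lsubmx : 'rV[R]_(m1 + m2) -> _) x = lsubmx :> (_ -> _).
    by rewrite diff_lin //; exact: continuous_lsubmx.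
  have -> : 'd (rsubmx : 'rV[R]_(m1 + m2) -> _) x = rsubmx :> (_ -> _).
    by rewrite diff_lin //; exact: continuous_rsubmx.
  by [].
split=> [x Ux|v].
  by apply: near_eq_differentiable (HE _ Ux) _; exact: (dH _ Ux).1.
apply: (IH _ _ _ (fD (lsubmx v)) (gD (rsubmx v))) => x Ux.
have [U1x U2x] := UU _ Ux; have [dHx dHE] := dH _ Ux.
rewrite -(near_eq_derive v (HE _ Ux)) (deriveE _ dHx) dHE.
by rewrite (deriveE _ (fd _ U1x)) (deriveE _ (gd _ U2x)).
Qed.

End Smooth.

Section Manifold.
Context (R : realType).

Record chart (T : topologicalType) (m : nat) := Chart {
  cdom : set T;
  cmap : T -> 'rV[R]_m;
  cinv : 'rV[R]_m -> T;
  cdom_open : open cdom;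
  cimg_open : open (cmap @` cdom);
  cmap_continuous : forall x, cdom x -> {for x, continuous cmap};
  cinv_continuous : forall u, (cmap @` cdom) u -> {for u, continuous cinv};
  cmapK : forall x, cdom x -> cinv (cmap x) = x }.

Definition cimg T m (c : chart T m) : set 'rV[R]_m := cmap c @` cdom c.

Definition overlap T m (c c' : chart T m) : set 'rV[R]_m :=
  [set u | cimg c u /\ cdom c' (cinv c u)].

Definition smooth_transition T m (c c' : chart T m) :=
  smooth_on (overlap c c') (fun u => cmap c' (cinv c u)).

(* The atlas is given as a family with one distinguished chart around each
   point (any atlas can be so presented, after choosing charts); this fixes a
   coordinate system on every tangent space, so T_xM is represented by
   'rV[R]_m through [chart_at x]. *)
Record manifold (m : nat) := Manifold {
  mcarrier :> topologicalType;
  chart_at : mcarrier -> chart mcarrier m;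
  mem_chart_at : forall x, cdom (chart_at x) x;
  chart_at_compat : forall x y, smooth_transition (chart_at x) (chart_at y);
  manifold_hausdorff : hausdorff_space mcarrier;
  manifold_sigma_compact : exists K : nat -> set mcarrier,
    (forall i, compact (K i)) /\ \bigcup_i K i = setT }.

Lemma overlap_open T m (c c' : chart T m) : open (overlap c c').
Proof.
rewrite openE => u [cu c'u]; rewrite /interior.
have n1 : nbhs u (cimg c).
  by apply: open_nbhs_nbhs; split => //; exact: cimg_open.
have n2 : nbhs (cinv c u) (cdom c').
  by apply: open_nbhs_nbhs; split => //; exact: cdom_open.
have {}n2 : \forall v \near u, cdom c' (cinv c v) := cinv_continuous cu n2.
by apply: filterS2 n1 n2 => v; split.
Qed.

Section ProdChart.
Context {T1 T2 : topologicalType} {m1 m2 : nat}.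
Variables (c1 : chart T1 m1) (c2 : chart T2 m2).

Let dom : set (T1 * T2) := [set p | cdom c1 p.1 /\ cdom c2 p.2].
Let map (p : T1 * T2) : 'rV[R]_(m1 + m2) := row_mx (cmap c1 p.1) (cmap c2 p.2).
Let inv (u : 'rV[R]_(m1 + m2)) : T1 * T2 := (cinv c1 (lsubmx u), cinv c2 (rsubmx u)).

Lemma prod_cimgE : map @` dom = [set u | cimg c1 (lsubmx u) /\ cimg c2 (rsubmx u)].
Proof.
apply/seteqP; split => [_ [p [d1 d2] <-]|u [[x d1 xu] [y d2 yu]]] /=.
  by rewrite /map row_mxKl row_mxKr; split; [exists p.1|exists p.2].
by exists (x, y) => //; rewrite /map /= xu yu hsubmxK.
Qed.

Let dom_open : open dom.
Proof.
rewrite openE => -[x y] [/= d1 d2]; exists (cdom c1, cdom c2) => //.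
by split; apply: open_nbhs_nbhs; split => //; exact: cdom_open.
Qed.

Let img_open : open (map @` dom).
Proof.
rewrite prod_cimgE; apply: openI; apply: open_comp.
- by move=> u _; exact: continuous_lsubmx.
- exact: cimg_open.
- by move=> u _; exact: continuous_rsubmx.
- exact: cimg_open.
Qed.

Let map_continuous p : dom p -> {for p, continuous map}.
Proof.
move=> [d1 d2]; apply: row_mx_continuous; apply: continuous_comp.
- exact: cvg_fst.
- exact: cmap_continuous.
- exact: cvg_snd.
- exact: cmap_continuous.
Qed.

Let inv_continuous u : (map @` dom) u -> {for u, continuous inv}.
Proof.
rewrite prod_cimgE => -[u1 u2].
have h1 : {for u, continuous (cinv c1 \o lsubmx)}.
  apply: continuous_comp; first exact: continuous_lsubmx.
  exact: cinv_continuous.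
have h2 : {for u, continuous (cinv c2 \o rsubmx)}.
  apply: continuous_comp; first exact: continuous_rsubmx.
  exact: cinv_continuous.
exact: (cvg_pair h1 h2).
Qed.

Let mapK p : dom p -> inv (map p) = p.
Proof.
by case: p => x y [/= d1 d2]; rewrite /inv /map row_mxKl row_mxKr !cmapK.
Qed.

Definition prod_chart : chart (T1 * T2)%type (m1 + m2) :=
  Chart dom_open img_open map_continuous inv_continuous mapK.

End ProdChart.

Section ProdManifold.
Context {m1 m2 : nat}.
Variables (M1 : manifold m1) (M2 : manifold m2).

Let prod_chart_at (p : M1 * M2) := prod_chart (chart_at p.1) (chart_at p.2).

Let mem_prod_chart_at p : cdom (prod_chart_at p) p.
Proof. by split; exact: mem_chart_at. Qed.

Let prod_chart_at_compat p q :
  smooth_transition (prod_chart_at p) (prod_chart_at q).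
Proof.
move=> k; have Ck1 := @chart_at_compat _ M1 p.1 q.1 k.
have Ck2 := @chart_at_compat _ M2 p.2 q.2 k.
have oU := @overlap_open _ _ (prod_chart_at p) (prod_chart_at q).
apply: (Ck_prod oU _ Ck1 Ck2) => // u.
by move=> [+ [? ?]]; rewrite /cimg prod_cimgE => -[? ?].
Qed.

Let prod_hausdorff : hausdorff_space (M1 * M2)%type.
Proof.
move=> [x1 x2] [y1 y2] xy; congr (_, _).
  apply: manifold_hausdorff => A B Ax By.
  have [|| [z1 z2] [[/= Az _] [/= Bz _]]] := xy (A `*` setT) (B `*` setT).
  - by exists (A, setT) => //; split => //; exact: filterT.
  - by exists (B, setT) => //; split => //; exact: filterT.
  by exists z1.
apply: manifold_hausdorff => A B Ax By.
have [|| [z1 z2] [[/= _ Az] [/= _ Bz]]] := xy (setT `*` A) (setT `*` B).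
- by exists (setT, A) => //; split => //; exact: filterT.
- by exists (setT, B) => //; split => //; exact: filterT.
by exists z2.
Qed.

Let prod_sigma_compact : exists K : nat -> set (M1 * M2)%type,
  (forall i, compact (K i)) /\ \bigcup_i K i = setT.
Proof.
have [K1 [cK1 K1T]] := manifold_sigma_compact M1.
have [K2 [cK2 K2T]] := manifold_sigma_compact M2.
pose ij (n : nat) : nat * nat := odflt (0, 0)%N (unpickle n).
exists (fun n => K1 (ij n).1 `*` K2 (ij n).2); split.
  by move=> n; exact: compact_setX.
apply/seteqP; split => // -[x y] _.
have [i _ xi] : (\bigcup_i K1 i) x by rewrite K1T.
have [j _ yj] : (\bigcup_j K2 j) y by rewrite K2T.
by exists (pickle (i, j)) => //; rewrite /ij pickleK.
Qed.

Definition prod_manifold : manifold (m1 + m2) :=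
  Manifold mem_prod_chart_at prod_chart_at_compat prod_hausdorff
    prod_sigma_compact.

End ProdManifold.
End Manifold.

Section Submanifold.
Context {R : realType} {m : nat} (M : manifold R m).
Implicit Types (Z : set M) (z : M).

(* c belongs to the maximal atlas of M *)
Definition compatible_chart (c : chart R M m) := forall x : M,
  smooth_transition c (chart_at x) /\ smooth_transition (chart_at x) c.

(* Embedded (not necessarily closed) submanifold of dimension p: near each of
   its points, Z is the slice where the last m - p coordinates vanish. *)
Definition submanifold (p : nat) Z := forall z, Z z ->
  exists c : chart R M m, [/\ (p <= m)%N, compatible_chart c, cdom c z &
    forall y, cdom c y ->
      (Z y <-> forall i : 'I_m, (p <= i)%N -> cmap c y ord0 i = 0)].

(* T_zZ: the velocities at z of the smooth curves of M drawn in Z, read in the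
   distinguished chart at z. *)
Definition tangent Z z : set 'rV[R]_m := [set v |
  exists c : R -> M, exists2 e : R, 0 < e &
    [/\ c 0 = z,
        forall t, `|t| < e -> Z (c t) /\ cdom (chart_at z) (c t),
        smooth_on [set t : R | `|t| < e] (fun t => cmap (chart_at z) (c t)) &
        'D_1 (fun t => cmap (chart_at z) (c t)) 0 = v]].

Definition clean_intersection Z1 Z2 :=
  (exists p, submanifold p (Z1 `&` Z2)) /\
  forall z, Z1 z -> Z2 z ->
    tangent (Z1 `&` Z2) z = tangent Z1 z `&` tangent Z2 z.

(* The excess of a clean intersection is codim (T_zZ1 + T_zZ2). *)
Definition transversal_intersection Z1 Z2 :=
  clean_intersection Z1 Z2 /\
  forall z, Z1 z -> Z2 z ->
    [set v1 + v2 | v1 in tangent Z1 z & v2 in tangent Z2 z] = setT.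

Definition patch (p : nat) Z (P : set M) := submanifold p P /\ P `<=` Z.

End Submanifold.

Section Maps.
Context {R : realType} {m k : nat} (M : manifold R m) (N : manifold R k).

(* f restricted to A is smooth: around each point of A it is, in charts, the
   restriction of a smooth map between open sets of the coordinate spaces.
   The values of f outside A are irrelevant. *)
Definition smooth_map_on (A : set M) (f : M -> N) := forall x, A x ->
  exists (U : set 'rV[R]_m) (g : 'rV[R]_m -> 'rV[R]_k),
    [/\ open U, U (cmap (chart_at x) x), smooth_on U g &
      forall y, A y -> cdom (chart_at x) y -> U (cmap (chart_at x) y) ->
        cdom (chart_at (f x)) (f y) /\
        cmap (chart_at (f x)) (f y) = g (cmap (chart_at x) y)].

Definition smooth_map (f : M -> N) := smooth_map_on setT f.

Definition mdiff (f : M -> N) (x : M) : 'rV[R]_m -> 'rV[R]_k :=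
  'd (fun u => cmap (chart_at (f x)) (f (cinv (chart_at x) u)))
     (cmap (chart_at x) x).

Definition submersion (f : M -> N) :=
  smooth_map f /\ forall x (w : 'rV[R]_k), exists v, mdiff f x v = w.

End Maps.

Section Diffeo.
Context {R : realType} {m k : nat} (M : manifold R m) (N : manifold R k).

(* The inverse map f(Z) -> Z is presented by a total g : N -> M with
   unspecified values outside f(Z). *)
Definition diffeo_onto_range (f : M -> N) (Z : set M) :=
  [/\ smooth_map_on Z f,
      forall y z, Z y -> Z z -> f y = f z -> y = z,
      exists q, submanifold q (f @` Z) &
      forall g : N -> M, (forall z, Z z -> g (f z) = z) ->
        smooth_map_on (f @` Z) g].

Definition local_diffeo (f : M -> N) (Z : set M) := forall z, Z z ->
  exists U : set M, [/\ open U, U z, open (f @` (Z `&` U)) &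
    diffeo_onto_range f (Z `&` U)].

End Diffeo.

Section Forms.
Context {R : realType}.

(* A bilinear form on each tangent space, in the distinguished coordinates. *)
Definition bilin_field m (M : manifold R m) := M -> 'M[R]_m.

Definition bilin m (A : 'M[R]_m) (v w : 'rV[R]_m) : R :=
  (v *m A *m w^T) ord0 ord0.

(* The coefficient of om on the constant vectors v, w in the chart around x,
   at the point of coordinates u. *)
Definition local_coef m (M : manifold R m) (om : bilin_field M) (x : M)
    (v w u : 'rV[R]_m) : R :=
  let y := cinv (chart_at x) u in
  let J := 'd (fun u' => cmap (chart_at y) (cinv (chart_at x) u')) u in
  bilin (om y) (J v) (J w).

(* A smooth closed nondegenerate 2-form. For constant vector fields the
   bracket terms of d(om) vanish. *)
Definition symplectic_form m (M : manifold R m) (om : bilin_field M) :=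
  [/\ forall x, (om x)^T = - om x,
      forall x, om x \in unitmx,
      forall x v w, smooth_on (cimg (chart_at x)) (local_coef om x v w) &
      forall x u, cimg (chart_at x) u -> forall v1 v2 v3,
        'D_v1 (local_coef om x v2 v3) u + 'D_v2 (local_coef om x v3 v1) u
        + 'D_v3 (local_coef om x v1 v2) u = 0].

Definition prod_form m1 m2 (M1 : manifold R m1) (M2 : manifold R m2)
    (om1 : bilin_field M1) (om2 : bilin_field M2) :
    bilin_field (prod_manifold M1 M2) :=
  fun p => block_mx (om1 p.1) 0 0 (om2 p.2).

Definition opp_form m (M : manifold R m) (om : bilin_field M) : bilin_field M :=
  fun x => - om x.

Definition lagrangian m (M : manifold R m) (om : bilin_field M) (Z : set M) :=
  submanifold m./2 Z /\
  forall z, Z z -> forall v w, tangent Z z v -> tangent Z z w ->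
    bilin (om z) v w = 0.

(* A Lagrangian local submanifold: a countable union of Lagrangian ones. *)
Definition lagrangian_local m (M : manifold R m) (om : bilin_field M)
    (Z : set M) :=
  exists P : nat -> set M, (forall j, lagrangian om (P j)) /\ Z = \bigcup_j P j.

End Forms.

(* The space of objects is a separate manifold, embedded in the arrows by
   [gunit]; [gmul] is total with unspecified values on non-composable pairs. *)
Record lie_groupoid (R : realType) (m d : nat) := LieGroupoid {
  arrows :> manifold R m;
  objects : manifold R d;
  grng : arrows -> objects;
  gsrc : arrows -> objects;
  gunit : objects -> arrows;
  ginv : arrows -> arrows;
  gmul : arrows -> arrows -> arrows;
  grng_unit : forall x, grng (gunit x) = x;
  gsrc_unit : forall x, gsrc (gunit x) = x;
  grng_mul : forall g h, gsrc g = grng h -> grng (gmul g h) = grng g;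
  gsrc_mul : forall g h, gsrc g = grng h -> gsrc (gmul g h) = gsrc h;
  gmulA : forall g h l, gsrc g = grng h -> gsrc h = grng l ->
    gmul g (gmul h l) = gmul (gmul g h) l;
  gmul1g : forall g, gmul (gunit (grng g)) g = g;
  gmulg1 : forall g, gmul g (gunit (gsrc g)) = g;
  grng_inv : forall g, grng (ginv g) = gsrc g;
  gsrc_inv : forall g, gsrc (ginv g) = grng g;
  gmulgV : forall g, gmul g (ginv g) = gunit (grng g);
  gmulVg : forall g, gmul (ginv g) g = gunit (gsrc g);
  grng_submersion : submersion grng;
  gsrc_submersion : submersion gsrc;
  gunit_smooth : smooth_map gunit;
  ginv_smooth : smooth_map ginv;
  gmul_smooth : @smooth_map_on R _ _ (prod_manifold arrows arrows) arrows
    [set p | gsrc p.1 = grng p.2] (fun p => gmul p.1 p.2) }.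

Section Groupoid.
Context {R : realType} {m d : nat} (G : lie_groupoid R m d).

Definition composable : set (prod_manifold G G) :=
  [set p | gsrc p.1 = grng p.2].

Definition gmul_graph : set (prod_manifold (prod_manifold G G) G) :=
  [set p | composable p.1 /\ p.2 = gmul p.1.1 p.1.2].

End Groupoid.

Record symplectic_groupoid (R : realType) (m d : nat) := SymplecticGroupoid {
  sgroupoid :> lie_groupoid R m d;
  sform : bilin_field sgroupoid;
  sform_symplectic : symplectic_form sform;
  gmul_graph_lagrangian :
    lagrangian (prod_form (prod_form sform sform) (opp_form sform))
      (@gmul_graph R m d sgroupoid) }.

Section Convolution.
Context {R : realType} {m d : nat} (G : symplectic_groupoid R m d).
Implicit Types L : set G.

(* L1 `*` L2, as a subset of the product manifold *)
Definition setX_arrows L1 L2 : set (prod_manifold G G) := L1 `*` L2.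

Definition cleanly_convolable L1 L2 :=
  clean_intersection (setX_arrows L1 L2) (@composable R m d G).

Definition transversally_convolable L1 L2 :=
  transversal_intersection (setX_arrows L1 L2) (@composable R m d G).

Definition convolution L1 L2 : set G :=
  [set gmul p.1 p.2 | p in setX_arrows L1 L2 `&` @composable R m d G].

(* r(L) and s(L), as subsets of G through the unit embedding *)
Definition range_set L : set G := (fun g => gunit (grng g)) @` L.
Definition source_set L : set G := (fun g => gunit (gsrc g)) @` L.

Definition is_inverse L L' :=
  [/\ lagrangian (@sform R m d G) L',
      cleanly_convolable L L', cleanly_convolable L' L,
      convolution L L' = range_set L & convolution L' L = source_set L].

Definition invertible L := exists L', is_inverse L L'.

Definition invertible_patch L P :=
  [/\ patch m./2 L P, lagrangian (@sform R m d G) P & invertible P].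

Definition locally_invertible L := forall g, L g ->
  exists P, invertible_patch L P /\ P g.

Definition is_local_inverse L L' :=
  lagrangian_local (@sform R m d G) L' /\
  exists (I : Type) (P Q : I -> set G),
    [/\ forall i, invertible_patch L (P i),
        forall i, is_inverse (P i) (Q i),
        L = \bigcup_i P i & L' = \bigcup_i Q i].

Definition star L : set G := @ginv R m d G @` L.

End Convolution.

(* Main.v *)
Require Import Defs.
From HB Require Import structures.
From mathcomp Require Import all_boot all_order all_algebra.
From mathcomp Require Import all_classical all_reals all_analysis.
From mathcomp Require Import ring lra.

(* If L' is an inverse of L, cancelling units shows that L' contains the
   inverses of the arrows of L, that r and s are injective on L, and that the
   composable pairs of L x L' are exactly the pairs (g, g^-1).  A vector v
   tangent to L and killed by ds gives a vector (v, 0) tangent both to L x L'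
   and to the composable pairs; by cleanness it is the velocity of a curve of
   pairs (g, g^-1), hence v = 0.  So r and s are immersions of L.  The unit space
   is isotropic and L has half the dimension of the arrows, so these immersions
   go between manifolds of equal dimension and the inverse function theorem makes
   them local diffeomorphisms.

   Conversely, if r and s are immersions of L, the composable pairs of L x L^*
   near (g, h^-1) form the graph of i o (s|L)^-1 o s, where (s|L)^-1 is the
   local inverse through h; this gives transversality.  If moreover r and s are
   injective on L, as they always are locally, then L^* is an inverse of L. *)

Set Implicit Arguments.
Unset Strict Implicit.
Unset Printing Implicit Defensive.

Import Order.TTheory GRing.Theory Num.Theory.
Import numFieldNormedType.Exports.

Local Open Scope classical_set_scope.
Local Open Scope ring_scope.

(** * Calculus of C^k maps *)

Section CkCalculus.
Context {R : realType}.
Implicit Types V W : normedModType R.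

(** The dimensions [m] of the arrows and [d] of the objects are independent parameters; their
    relation has to be derived, [d <= m./2] from the isotropy of the units and [m./2 <= d] from an
    immersion of [L] into the objects. The symplectic form acts through one identity, the isotropy
    of the multiplication graph, evaluated on velocities of curves of triples (x, x, x) of units and
    (g, g^-1, unit).

    A tangent vector is a coordinate vector in a distinguished chart that changes with the point, so
    computing with differentials alone would mean tracking transition maps everywhere. Instead,
    vectors are handled as velocities of curves: two vectors are shown equal by giving both as
    velocities of the same germ of curve, and a vector is shown tangent to a set by drawing a curve
    in that set. Submersions are used through the lifting of curves with a prescribed initial
    velocity, which is how vectors tangent to the composable pairs are produced. *)

Lemma Ck_eq k V W (U : set V) (f g : V -> W) : open U ->
  (forall x, U x -> f x = g x) -> Ck k U f -> Ck k U g.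
Proof.
move=> oU; elim: k f g => [|k IH] f g /= fg.
  move=> fc x Ux; apply: near_eq_continuous (fc x Ux).
  by apply: filterS (open_nbhs_nbhs (conj oU Ux)) => y /fg.
have nfg x : U x -> \near x, f x = g x.
  by move=> Ux; apply: filterS (open_nbhs_nbhs (conj oU Ux)) => y /fg.
move=> [fd fD]; split=> [x Ux|v].
  exact: near_eq_differentiable (nfg _ Ux) (fd _ Ux).
apply: IH (fD v) => x Ux; apply: near_eq_derive; exact: nfg.
Qed.

Lemma Ck_subset k V W (U U' : set V) (f : V -> W) :
  U `<=` U' -> Ck k U' f -> Ck k U f.
Proof.
move=> UU; elim: k f => [|k IH] f /=; first by move=> fc x /UU/fc.
by move=> [fd fD]; split=> [x /UU/fd //|v]; exact: IH.
Qed.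

Lemma Ck_continuous k V W (U : set V) (f : V -> W) x :
  Ck k U f -> U x -> {for x, continuous f}.
Proof.
case: k => [|k] /=; first exact.
by move=> [fd _] Ux; exact: differentiable_continuous (fd _ Ux).
Qed.

Lemma CkW k V W (U : set V) (f : V -> W) : Ck k.+1 U f -> Ck k U f.
Proof.
elim: k f => [|k IH] f; first by move=> fC x; exact: Ck_continuous fC.
by move=> [fd fD]; split=> // v; exact: IH.
Qed.

(** [N] may be any set containing [x]: [Ck] speaks of the iterated derivatives of [f] at the points
    of the set, and these depend on [f] in the whole space around them. *)
Lemma Ck_local k V W (U : set V) (f : V -> W) :
  (forall x, U x -> exists2 N : set V, N x & Ck k N f) -> Ck k U f.
Proof.
elim: k f => [|k IH] f /= fC.
  by move=> x Ux; have [N Nx] := fC _ Ux; apply.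
split=> [x /fC[N Nx [fd _]]|v]; first exact: fd.
by apply: IH => x /fC[N Nx [_ fD]]; exists N.
Qed.

Lemma Ck_cst k V W (U : set V) (a : W) : Ck k U (fun _ : V => a).
Proof.
elim: k a => [|k IH] a /=; first by move=> x _; exact: cst_continuous.
split=> [x _|v]; first exact: differentiable_cst.
by under eq_fun do rewrite derive_cst; exact: IH.
Qed.

Lemma Ck_linear k V W W' (U : set V) (L : {linear W -> W'}) (f : V -> W) :
  open U -> continuous L -> Ck k U f -> Ck k U (fun x => L (f x)).
Proof.
move=> oU Lc; elim: k f => [|k IH] f /=.
  by move=> fc x Ux; apply: continuous_comp; [exact: fc|exact: Lc].
move=> [fd fD]; have LfD x := @diff_comp_lin R V W W' L f x Lc.
split=> [x /fd /LfD[] //|v].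
apply: Ck_eq (IH _ (fD v)) => // x /fd dfx.
by have [dLf dLfE] := LfD _ dfx; rewrite !deriveE // -dLfE.
Qed.

Lemma Ck_id k V (U : set V) : Ck k U (@id V).
Proof.
case: k => [|k] /=; first by move=> x _; exact: cvg_id.
split=> [x _|v]; first exact: ex_diff.
by under eq_fun do rewrite derive_id; exact: Ck_cst.
Qed.

Lemma CkD k V W (U : set V) (f g : V -> W) : open U ->
  Ck k U f -> Ck k U g -> Ck k U (fun x => f x + g x).
Proof.
move=> oU; elim: k f g => [|k IH] f g /=.
  by move=> fc gc x Ux; apply: continuousD; [exact: fc|exact: gc].
move=> [fd fD] [gd gD]; split=> [x Ux|v].
  by apply: (@differentiableD _ _ _ f g); [exact: fd|exact: gd].
apply: Ck_eq (IH _ _ (fD v) (gD v)) => // x Ux.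
by apply/esym/(@deriveD _ _ _ f g); apply: diff_derivable; [exact: fd|exact: gd].
Qed.

Lemma Ck_sum k V W (U : set V) I (r : seq I) (P : pred I) (f : I -> V -> W) :
  open U -> (forall i, Ck k U (f i)) ->
  Ck k U (fun x => \sum_(i <- r | P i) f i x).
Proof.
move=> oU fC; elim: r => [|i r IH].
  by apply: (Ck_eq oU _ (Ck_cst k U 0)) => x _; rewrite big_nil.
have [Pi|Pi] := boolP (P i).
  apply: (Ck_eq oU _ (CkD oU (fC i) IH)) => x _.
  by rewrite big_cons Pi.
by apply: (Ck_eq oU _ IH) => x _; rewrite big_cons (negbTE Pi).
Qed.

Lemma CkM k V (U : set V) (f g : V -> R) : open U ->
  Ck k U f -> Ck k U g -> Ck k U (fun x => f x * g x).
Proof.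
move=> oU; elim: k f g => [|k IH] f g fC gC.
  by move=> x Ux; apply: continuousM; [exact: fC|exact: gC].
have [[fd fD] [gd gD]] := (fC, gC); split=> [x Ux|v].
  by apply: (@differentiableM _ _ f g); [exact: fd|exact: gd].
have gfC := CkD oU (IH _ _ (CkW fC) (gD v)) (IH _ _ (CkW gC) (fD v)).
apply: Ck_eq gfC => // x Ux.
by apply/esym/(@deriveM _ _ f g); apply: diff_derivable; [exact: fd|exact: gd].
Qed.

Lemma Ck_prod_seq k V (U : set V) I (r : seq I) (P : pred I) (f : I -> V -> R) :
  open U -> (forall i, Ck k U (f i)) ->
  Ck k U (fun x => \prod_(i <- r | P i) f i x).
Proof.
move=> oU fC; elim: r => [|i r IH].
  by apply: (Ck_eq oU _ (Ck_cst (W:=R) k U 1)) => x _; rewrite big_nil.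
have [Pi|Pi] := boolP (P i).
  apply: (Ck_eq oU _ (CkM oU (fC i) IH)) => x _.
  by rewrite big_cons Pi.
by apply: (Ck_eq oU _ IH) => x _; rewrite big_cons (negbTE Pi).
Qed.

Lemma CkV k V (U : set V) (f : V -> R) : open U ->
  (forall x, U x -> f x != 0) -> Ck k U f -> Ck k U (fun x => (f x)^-1).
Proof.
move=> oU f0; elim: k => [|k IH] fC.
  by move=> x Ux; apply: continuousV; [exact: f0|exact: fC].
have [fd fD] := fC; split=> [x Ux|v].
  by apply: (@differentiableV _ _ f); [exact: fd|exact: f0].
have C1 := IH (CkW fC).
have C2 := CkM oU (Ck_cst (W:=R) k U (-1)) (CkM oU (CkM oU C1 C1) (fD v)).
apply: Ck_eq C2 => // x Ux.
apply/esym/(etrans (@deriveV _ _ f _ _ _ _)); first exact: f0.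
  by apply: diff_derivable; exact: fd.
by rewrite mulN1r expr2 invfM -[LHS]/(- ((f x)^-1 / f x) * 'D_v f x) mulNr.
Qed.

Lemma coord_linear n (j : 'I_n) : exists2 L : {linear 'rV[R]_n -> R},
  continuous L & forall u, L u = u ord0 j.
Proof.
pose L (u : 'rV[R]_n) : R := u ord0 j.
have Ll : linear L by move=> a u v; rewrite /L !mxE.
pose LL : {linear _ -> _} := HB.pack L (GRing.isLinear.Build _ _ _ _ _ Ll).
by exists LL => // u; exact: coord_continuous.
Qed.

Lemma linear_rV_continuous n W (L : {linear 'rV[R]_n -> W}) : continuous L.
Proof.
move=> u.
have -> : L = (fun x : 'rV[R]_n => \sum_j x ord0 j *: L (delta_mx ord0 j)) :>
  (_ -> _).
  apply/funext => x; rewrite {1}(row_sum_delta x) linear_sum.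
  by apply: eq_bigr => j _; rewrite linearZ.
apply: (@Ck_continuous 0 _ _ setT) => //.
apply: Ck_sum => [|j x _]; first exact: openT.
apply: continuousZl; exact: coord_continuous.
Qed.

Lemma scalel_linear W (w : W) : exists2 L : {linear R -> W},
  continuous L & forall a, L a = a *: w.
Proof.
pose L (a : R) : W := a *: w.
have Ll : linear L by move=> a u v; rewrite /L scalerDl scalerA.
pose LL : {linear R -> _} := HB.pack L (GRing.isLinear.Build _ _ _ _ _ Ll).
by exists LL => // u; apply: (@continuousZl _ _ _ id); exact: cvg_id.
Qed.

Lemma Ck_rowP k V n (U : set V) (f : V -> 'rV[R]_n) : open U ->
  Ck k U f <-> forall j, Ck k U (fun x => f x ord0 j).
Proof.
move=> oU; split=> [fC j|fC].
  have [L Lc LE] := coord_linear j.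
  by under eq_fun do rewrite -LE; apply: Ck_linear.
apply: (Ck_eq (f := fun x => \sum_j f x ord0 j *: delta_mx ord0 j)) => //.
  by move=> x _; rewrite -row_sum_delta.
apply: Ck_sum => // j.
have [L Lc LE] := scalel_linear (delta_mx ord0 j : 'rV[R]_n).
by under eq_fun do rewrite -LE; apply: Ck_linear.
Qed.

Lemma derive_coord V n (f : V -> 'rV[R]_n) (x v : V) j : differentiable f x ->
  'D_v (fun y => f y ord0 j) x = ('D_v f x) ord0 j.
Proof.
move=> df; have [L Lc LE] := coord_linear j.
have [dL dLE] := diff_comp_lin Lc df.
under eq_fun do rewrite -LE.
by rewrite deriveE // dLE LE deriveE.
Qed.

(** The chain rule in coordinates presents the derivative of a composite as a sum of products, the
    form on which the induction of [Ck_comp_scalar] can act. *)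
Lemma derive_comp V n W (f : V -> 'rV[R]_n) (g : 'rV[R]_n -> W) (x v : V) :
  differentiable f x -> differentiable g (f x) ->
  'D_v (g \o f) x = \sum_j 'D_v (fun y => f y ord0 j) x *: 'D_(delta_mx ord0 j)
    g (f x).
Proof.
move=> df dg; rewrite deriveE; last exact: differentiable_comp.
rewrite diff_comp // /= -(deriveE v df) {1}(row_sum_delta ('D_v f x)) linear_sum.
by apply: eq_bigr => j _;
  rewrite linearZ derive_coord // (deriveE (delta_mx ord0 j) dg).
Qed.

Lemma Ck_comp_scalar k V n (U : set V) (U' : set 'rV[R]_n) (f : V -> 'rV[R]_n)
    (g : 'rV[R]_n -> R) : open U -> (forall x, U x -> U' (f x)) ->
  Ck k U f -> Ck k U' g -> Ck k U (g \o f).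
Proof.
move=> oU UU; elim: k g => [|k IH] g fC gC.
  by move=> x Ux; apply: continuous_comp; [exact: fC|exact/gC/UU].
have [[fd fD] [gd gD]] := (fC, gC); split=> [x Ux|v].
  by apply: differentiable_comp; [exact: fd|exact/gd/UU].
pose h x := \sum_j 'D_v (fun y => f y ord0 j) x * ('D_(delta_mx ord0 j) g \o f) x.
apply: (Ck_eq (f := h)) => //.
  by move=> x Ux; rewrite derive_comp; [|exact: fd|exact/gd/UU].
apply: Ck_sum => // j; apply: CkM => //.
  by have [_] := (Ck_rowP k.+1 f oU).1 fC j; apply.
by apply: IH; [exact: CkW|exact: gD].
Qed.

Lemma Ck_comp k V n p (U : set V) (U' : set 'rV[R]_n) (f : V -> 'rV[R]_n)
    (g : 'rV[R]_n -> 'rV[R]_p) : open U -> open U' ->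
  (forall x, U x -> U' (f x)) ->
  Ck k U f -> Ck k U' g -> Ck k U (g \o f).
Proof.
move=> oU oU' UU fC gC; apply/(Ck_rowP _ _ oU) => j.
exact: (Ck_comp_scalar (g := fun u => g u ord0 j)) fC ((Ck_rowP k g oU').1 gC j).
Qed.

Lemma Ck_det k V n (U : set V) (A : V -> 'M[R]_n) : open U ->
  (forall i j, Ck k U (fun x => A x i j)) -> Ck k U (fun x => \det (A x)).
Proof.
move=> oU AC; apply: Ck_sum => // s; apply: CkM => //; first exact: Ck_cst.
by apply: Ck_prod_seq.
Qed.

(** By Cramer's formula each entry of the inverse is a cofactor divided by the determinant. *)
Lemma Ck_invmx k V n (U : set V) (A : V -> 'M[R]_n) : open U ->
  (forall x, U x -> A x \in unitmx) -> (forall i j, Ck k U (fun x => A x i j)) ->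
  forall i j, Ck k U (fun x => invmx (A x) i j).
Proof.
move=> oU Au AC i j.
pose h x := (\det (A x))^-1 * ((-1) ^+ (j + i) * \det (row' j (col' i (A x)))).
apply: (Ck_eq (f := h)) => //.
  by move=> x /Au Aux; rewrite /invmx Aux !mxE.
apply: CkM => //.
  apply: CkV => //; last exact: Ck_det.
  by move=> x /Au; rewrite unitmxE unitfE.
apply: CkM => //; first exact: Ck_cst.
by apply: Ck_det => // a b; apply: Ck_eq (AC (lift j a) (lift i b)) => // x _;
  rewrite !mxE.
Qed.

Lemma near_open (T : topologicalType) (P : T -> Prop) x :
  (\near x, P x) -> exists A : set T, [/\ open A, A x & forall y, A y -> P y].
Proof.
move=> xP; have : nbhs x [set y | P y] := xP.
by rewrite nbhsE => -[A [oA Ax] AP]; exists A.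
Qed.

(** Hiding the open domain turns smoothness into a property of germs, so that composites and changes
    of chart need no bookkeeping of domains. *)
Definition smooth_at V W (f : V -> W) x :=
  exists U : set V, [/\ open U, U x & smooth_on U f].

Lemma smooth_on_at V W (U : set V) (f : V -> W) x :
  open U -> smooth_on U f -> U x -> smooth_at f x.
Proof. by exists U. Qed.

Lemma smooth_at_on V W (U : set V) (f : V -> W) :
  (forall x, U x -> smooth_at f x) -> smooth_on U f.
Proof.
by move=> fs k; apply: Ck_local => x /fs[N [_ Nx fN]]; exists N.
Qed.

Lemma near_smooth_at V W (f : V -> W) x :
  smooth_at f x -> \near x, smooth_at f x.
Proof.
move=> [U [oU Ux fU]]; apply: filterS (open_nbhs_nbhs (conj oU Ux)) => y.
exact: smooth_on_at fU.
Qed.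

Lemma smooth_at_continuous V W (f : V -> W) x :
  smooth_at f x -> {for x, continuous f}.
Proof. by move=> [U [oU Ux fU]]; exact: (fU 0%N). Qed.

Lemma smooth_at_differentiable V W (f : V -> W) x :
  smooth_at f x -> differentiable f x.
Proof. by move=> [U [oU Ux fU]]; exact: (fU 1%N).1. Qed.

Lemma near_eq_smooth_at V W (f g : V -> W) x :
  (\near x, f x = g x) -> smooth_at f x -> smooth_at g x.
Proof.
move=> /near_open[A [oA Ax fg]] [U [oU Ux fU]].
exists (A `&` U); split => //; first exact: openI.
move=> k; apply: (Ck_eq (f := f)); [exact: openI|by move=> y [/fg]|].
exact: Ck_subset (fU k).
Qed.

Lemma smooth_at_comp V n p (f : V -> 'rV[R]_n) (g : 'rV[R]_n -> 'rV[R]_p) x :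
  smooth_at f x -> smooth_at g (f x) -> smooth_at (g \o f) x.
Proof.
move=> /[dup] fx [U [oU Ux fU]] [U' [oU' U'x gU']].
have : \near x, U x /\ U' (f x).
  apply: filterI; first exact: open_nbhs_nbhs.
  exact: (smooth_at_continuous fx (open_nbhs_nbhs (conj oU' U'x))).
move=> /near_open[A [oA Ax AU]].
exists A; split => // k; apply: Ck_comp (gU' k) => //.
  by move=> y /AU[].
by apply: Ck_subset (fU k) => y /AU[].
Qed.

Lemma smooth_at_cst V W (a : W) x : smooth_at (fun _ : V => a) x.
Proof. by exists setT; split=> [||k]; [exact: openT|by []|exact: Ck_cst]. Qed.

Lemma smooth_at_linear V W W' (L : {linear W -> W'}) (f : V -> W) x :
  continuous L -> smooth_at f x -> smooth_at (fun y => L (f y)) x.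
Proof.
by move=> Lc [U [oU Ux fU]]; exists U; split => // k; exact: Ck_linear.
Qed.

Lemma smooth_at_id V x : smooth_at (@id V) x.
Proof. by exists setT; split=> [||k]; [exact: openT|by []|exact: Ck_id]. Qed.

Lemma smooth_atD V W (f g : V -> W) x :
  smooth_at f x -> smooth_at g x -> smooth_at (fun y => f y + g y) x.
Proof.
move=> [U [oU Ux fU]] [U' [oU' U'x gU']]; exists (U `&` U'); split => //.
  exact: openI.
move=> k; apply: CkD; first exact: openI.
  by apply: Ck_subset (fU k) => y [].
by apply: Ck_subset (gU' k) => y [].
Qed.

Lemma smooth_at_mulmx V n p (f : V -> 'rV[R]_n) (A : 'M[R]_(n, p)) x :
  smooth_at f x -> smooth_at (fun y => f y *m A) x.
Proof.
move=> fx; apply: (smooth_at_linear (L := mulmxr A)) => //.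
exact: linear_rV_continuous.
Qed.

Lemma smooth_atB V n (f g : V -> 'rV[R]_n) x :
  smooth_at f x -> smooth_at g x -> smooth_at (fun y => f y - g y) x.
Proof.
move=> fx gx; apply: smooth_atD => //.
have := smooth_at_mulmx (- 1%:M) gx.
by apply: near_eq_smooth_at; near=> y; rewrite mulmxN mulmx1.
Unshelve. all: by end_near. Qed.

Lemma smooth_at_row_mx V n p (f : V -> 'rV[R]_n) (g : V -> 'rV[R]_p) x :
  smooth_at f x -> smooth_at g x -> smooth_at (fun y => row_mx (f y) (g y)) x.
Proof.
move=> fx gx.
have := smooth_atD (smooth_at_mulmx (row_mx 1%:M 0) fx)
  (smooth_at_mulmx (row_mx 0 1%:M) gx).
apply: near_eq_smooth_at; near=> y.
by rewrite !mul_mx_row !mulmx1 !mulmx0 add_row_mx addr0 add0r.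
Unshelve. all: by end_near. Qed.

Lemma mulmx_lsubmx n p (u : 'rV[R]_(n + p)) : u *m col_mx 1%:M 0 = lsubmx u.
Proof. by rewrite -[u in LHS]hsubmxK mul_row_col mulmx1 mulmx0 addr0. Qed.

Lemma mulmx_rsubmx n p (u : 'rV[R]_(n + p)) : u *m col_mx 0 1%:M = rsubmx u.
Proof. by rewrite -[u in LHS]hsubmxK mul_row_col mulmx1 mulmx0 add0r. Qed.

Lemma smooth_at_lsubmx V n p (f : V -> 'rV[R]_(n + p)) x :
  smooth_at f x -> smooth_at (fun y => lsubmx (f y)) x.
Proof.
move=> fx; have := smooth_at_mulmx (col_mx 1%:M 0 : 'M[R]_(n + p, n)) fx.
by congr smooth_at; apply/funext => y; rewrite mulmx_lsubmx.
Qed.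

Lemma smooth_at_rsubmx V n p (f : V -> 'rV[R]_(n + p)) x :
  smooth_at f x -> smooth_at (fun y => rsubmx (f y)) x.
Proof.
move=> fx; have := smooth_at_mulmx (col_mx 0 1%:M : 'M[R]_(n + p, p)) fx.
by congr smooth_at; apply/funext => y; rewrite mulmx_rsubmx.
Qed.

Lemma derive_mulmx V n p (f : V -> 'rV[R]_n) (A : 'M[R]_(n, p)) (x v : V) :
  differentiable f x -> 'D_v (fun y => f y *m A) x = 'D_v f x *m A.
Proof.
pose L : {linear 'rV[R]_n -> 'rV[R]_p} := mulmxr A.
have Lc : continuous L := @linear_rV_continuous _ _ L.
move=> df; have [dL dLE] := diff_comp_lin Lc df.
have -> : (fun y => f y *m A) = L \o f by [].
by rewrite deriveE // dLE deriveE.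
Qed.

Lemma smooth_at_scalel W (w : W) (t : R) : smooth_at (fun t : R => t *: w) t.
Proof.
have [L Lc LE] := scalel_linear w.
apply: near_eq_smooth_at (smooth_at_linear Lc (smooth_at_id t)).
by near=> s; rewrite LE.
Unshelve. all: by end_near. Qed.

End CkCalculus.

(** * The inverse function theorem *)

Section InverseFunction.
Context {R : realType}.
Implicit Types V W : normedModType R.

Lemma le_rV_norm n (u : 'rV[R]_n) j : `|u ord0 j| <= `|u|.
Proof.
rewrite [leRHS]/Num.Def.normr /= mx_normrE; apply/bigmax_geP; right => /=.
by exists (ord0, j).
Qed.

Lemma rV_norm_le n (u : 'rV[R]_n) e : 0 <= e ->
  (forall j, `|u ord0 j| <= e) -> `|u| <= e.
Proof.
move=> e0 ue; rewrite [leLHS]/Num.Def.normr /= mx_normrE; apply/bigmax_leP;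
  split => //.
by move=> [i j] _ /=; rewrite (ord1 i).
Qed.

Lemma derive_diff_comp V W W' (f : V -> W) (g : W -> W') (x v : V) :
  differentiable f x -> differentiable g (f x) ->
  'D_v (g \o f) x = 'd g (f x) ('D_v f x).
Proof.
move=> df dg; rewrite deriveE; last exact: differentiable_comp.
by rewrite diff_comp // deriveE.
Qed.

Lemma derive_affine V W (a : W) (L : {linear V -> W}) (x v : V) : continuous L ->
  differentiable (fun y => a + L y) x /\ 'D_v (fun y => a + L y) x = L v.
Proof.
move=> Lc; have dL := @linear_differentiable _ _ _ L x Lc.
have dc := @differentiable_cst _ V W a x.
have df := differentiableD dc dL.
split=> //; rewrite (@deriveE _ _ _ (fun y => a + L y)) //.
by rewrite (diffD dc dL) diff_cst (diff_lin _ Lc); exact: add0r.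
Qed.

Lemma derive_line W (y w : W) (t : R) :
  differentiable (fun t : R => y + t *: w) t /\
  'D_1 (fun t : R => y + t *: w) t = w.
Proof.
have [L Lc LE] := scalel_linear w.
have -> : (fun t => y + t *: w) = (fun t => y + L t).
  by apply/funext => s; rewrite LE.
have [dL ->] := derive_affine y t 1 Lc.
by rewrite LE scale1r.
Qed.

Lemma norm_diff_le n (h : 'rV[R]_n -> 'rV[R]_n) (x w : 'rV[R]_n) e : 0 <= e ->
  differentiable h x -> (forall j, `|'D_(delta_mx ord0 j) h x| <= e) ->
  `|'d h x w| <= n%:R * e * `|w|.
Proof.
move=> e0 dh he; rewrite {1}(row_sum_delta w) linear_sum.
apply: le_trans (ler_norm_sum _ _ _) _.
apply: le_trans (_ : \sum_(j < n) e * `|w| <= _).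
  apply: ler_sum => j _; rewrite linearZ -deriveE // normrZ mulrC.
  by apply: ler_pM => //; exact: le_rV_norm.
by rewrite sumr_const card_ord -mulrA mulr_natl.
Qed.

Lemma small_diff_near n (h : 'rV[R]_n -> 'rV[R]_n) x0 e : 0 < e ->
  smooth_at h x0 -> 'd h x0 = 0 :> (_ -> _) ->
  \forall x \near x0, forall w, `|'d h x w| <= e * `|w|.
Proof.
(* Each of the [n] partial derivatives is made at most [e / n.+1], so that their sum is at most [e];
   the successor covers [n = 0]. *)
move=> e0 [U [oU Ux hU]] h0; pose e' := e / n.+1%:R.
have e'0 : 0 < e' by rewrite divr_gt0.
have nU : \forall x \near x0, U x := open_nbhs_nbhs (conj oU Ux).
have nD : \forall x \near x0, forall j : 'I_n, `|'D_(delta_mx ord0 j) h x| <= e'.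
  apply: (@filter_forall _ _ (fun j x => `|'D_(delta_mx ord0 j) h x| <= e')
    (nbhs x0)) => j.
  have c := (hU 1%N).2 (delta_mx ord0 j) x0 Ux.
  have : \forall x \near x0,
    ball ('D_(delta_mx ord0 j) h x0) e' ('D_(delta_mx ord0 j) h x).
    exact: (c _ (nbhsx_ballx _ _ e'0)).
  apply: filterS => x; rewrite deriveE; last exact: (hU 1%N).1.
  by rewrite h0 -ball_normE /= add0r normrN => /ltW.
apply: filterS2 nU nD => x Ux' hx w.
apply: le_trans (norm_diff_le _ (ltW e'0) _ hx) _; first exact: (hU 1%N).1.
apply: ler_wpM2r => //; rewrite /e' mulrCA ler_piMr ?(ltW e0)//.
by rewrite ler_pdivrMr ?ltr0n// mul1r ler_nat.
Qed.

(** The norm of row vectors is the sup norm, so it is enough to apply the scalar mean value theorem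
    to each coordinate along the segment; the intermediate point may depend on the coordinate. *)
Lemma mean_value_ball n (h : 'rV[R]_n -> 'rV[R]_n) x0 r e : 0 <= e ->
  (forall x, ball x0 r x -> differentiable h x) ->
  (forall x, ball x0 r x -> forall w, `|'d h x w| <= e * `|w|) ->
  forall x y, ball x0 r x -> ball x0 r y -> `|h x - h y| <= e * `|x - y|.
Proof.
move=> e0 dh he x y bx byy; apply: rV_norm_le => [|i].
  by rewrite mulr_ge0.
pose line (t : R) := y + t *: (x - y).
have bl (t : R) : t \in `[0, 1] -> ball x0 r (line t).
  rewrite in_itv /= => /andP[t0 t1]; move: bx byy; rewrite -ball_normE /= => bx byy.
  have -> : x0 - line t = (1 - t) *: (x0 - y) + t *: (x0 - x).
    by apply/rowP => j; rewrite /line !mxE; ring.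
  apply: le_lt_trans (ler_normD _ _) _; rewrite !normrZ.
  rewrite !ger0_norm ?subr_ge0 //.
  have [->|tn0] := eqVneq t 0; first by rewrite subr0 mul1r mul0r addr0.
  have tp : 0 < t by rewrite lt_neqAle eq_sym tn0.
  have h1 : t * `|x0 - x| < t * r by rewrite ltr_pM2l.
  have h2 : (1 - t) * `|x0 - y| <= (1 - t) * r by apply: ler_wpM2l;
    [rewrite subr_ge0|exact: ltW].
  by lra.
pose phi (t : R) : R := h (line t) ord0 i.
have dphi (t : R) : t \in `[0, 1] ->
  is_derive t 1 phi ('d h (line t) (x - y) ord0 i).
  move=> /bl blt; have [dl dlE] := derive_line y (x - y) t.
  have dhl := @differentiable_comp _ _ _ _ _ _ _ dl (dh _ blt).
  have [L Lc LE] := coord_linear (R := R) i.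
  have [dL dLE] := diff_comp_lin Lc dhl.
  have -> : phi = L \o (h \o line) by apply/funext => s; rewrite /= LE.
  have dd : derivable (L \o (h \o line)) t 1 by exact: diff_derivable.
  have E : 'D_1 (L \o (h \o line)) t = 'd h (line t) (x - y) ord0 i.
    by rewrite deriveE // dLE LE -deriveE // derive_diff_comp ?dlE //; exact: dh.
  exact: DeriveDef dd E.
pose psi (t : R) : R := 'd h (line t) (x - y) ord0 i.
have phiD (t : R) : t \in `]0, 1[ -> is_derive t 1 phi (psi t).
  by move=> t01; apply: dphi; exact: subset_itv_oo_cc.
have phiC : {within `[0, 1], continuous phi}.
  by apply: derivable_within_continuous => t t01; have [] := dphi _ t01.
have [c c01] := MVT_segment ler01 phiD phiC.
rewrite /phi /line scale0r scale1r addr0 addrCA subrr addr0 subr0 mulr1 => hE.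
rewrite !mxE hE; apply: le_trans (le_rV_norm _ _) _.
by apply: he; exact: bl.
Qed.

(* Take a minimizer c of the residual |y - (x - h x)| over a closed ball: moving c
   by its residual stays in the ball and halves the residual, which is thus 0. *)
Lemma perturbed_id_surj n (h : 'rV[R]_n -> 'rV[R]_n) x0 r y : 0 < r ->
  (forall x, ball x0 r x -> {for x, continuous h}) ->
  (forall x x', ball x0 r x -> ball x0 r x' -> `|h x - h x'| <= 2^-1 * `|x - x'|) ->
  `|y - (x0 - h x0)| < r / 10 ->
  exists2 x, ball x0 (r / 2) x & x - h x = y.
Proof.
move=> r0 hc hl; set d := `|_| => dr.
pose A := closed_ball x0 (r / 2).
have AE : A = [set x | `|x0 - x| <= r / 2] by rewrite /A closed_ballE ?divr_gt0.
have Ar x : A x -> ball x0 r x.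
  by rewrite AE -ball_normE /=; move=> /le_lt_trans; apply; lra.
have Ax0 : A x0 by rewrite AE /= subrr normr0; lra.
have cA : compact A.
  apply: bounded_closed_compact; last exact: closed_ball_closed.
  exists (`|x0| + r / 2); split; first exact: num_real.
  move=> M MM x; rewrite AE /= => xr.
  have := ler_normB x0 (x0 - x); rewrite subKr; lra.
pose phi x := `|y - (x - h x)|.
have phic : {within A, continuous phi}.
  apply: continuous_in_subspaceT => x /set_mem /Ar /hc hx.
  apply: continuous_comp; last exact: norm_continuous.
  apply: continuousB; first exact: cst_continuous.
  by apply: continuousB => //; exact: cvg_id.
have [c /set_mem Ac cmin] := EVT_min_rV (ex_intro A x0 Ax0) cA phic.
have cd : phi c <= d by exact/cmin/mem_set.
have hcx := hl c x0 (Ar _ Ac) (Ar _ Ax0).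
(* The distance is at most half of itself plus [d] plus [phi c], and [phi c <= d] by comparison with
   [x0]. The next point [x'] is then within [5 * d] of [x0], which has to be at most [r / 2]: this
   is the origin of [r / 10]. *)
have cx : `|c - x0| <= 4 * d.
  have E : c - x0 = (h c - h x0) + (y - (x0 - h x0)) - (y - (c - h c)).
    by apply/rowP => j; rewrite !mxE; ring.
  have := ler_normB ((h c - h x0) + (y - (x0 - h x0))) (y - (c - h c)).
  have := ler_normD (h c - h x0) (y - (x0 - h x0)).
  rewrite -E -/(phi c) -/d; move: hcx cd; lra.
pose x' := c + (y - (c - h c)).
have x'c : x' - c = y - (c - h c) by rewrite /x' addrC addKr.
have Ax' : A x'.
  rewrite AE /= distrC.
  have -> : x' - x0 = (c - x0) + (y - (c - h c)) by rewrite /x' addrAC.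
  apply: le_trans (ler_normD _ _) _; rewrite -/(phi c).
  by move: cx cd dr; lra.
have : phi c <= phi x' by exact/cmin/mem_set.
have -> : phi x' = `|h x' - h c|.
  by congr `|_|; rewrite /x'; apply/rowP => j; rewrite !mxE; ring.
have := hl x' c (Ar _ Ax') (Ar _ Ac); rewrite x'c -/(phi c) => h1 h2.
have phi0 : phi c <= 0 by move: h1 h2; lra.
exists c.
  rewrite -ball_normE /= distrC; move: cx dr; lra.
by apply/esym/eqP; rewrite -subr_eq0 -normr_le0.
Qed.

Lemma mul_jacobian n p (f : 'rV[R]_n -> 'rV[R]_p) (x v : 'rV[R]_n) :
  v *m 'J f x = 'd f x v.
Proof. by rewrite mul_rV_lin1. Qed.

Lemma injective_unitmx n (A : 'M[R]_n) :
  (forall v : 'rV_n, v *m A = 0 -> v = 0) -> A \in unitmx.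
Proof. by move=> Ai; rewrite -row_free_unit; exact: inj_row_free. Qed.

Lemma differentiable_approx V W (f : V -> W) (x : V) e : differentiable f x ->
  0 < e -> exists2 r, 0 < r &
    forall k, `|k| < r -> `|f (k + x) - (f x + 'd f x k)| <= e * `|k|.
Proof.
move=> df e0; have [_ /eqaddoP dfE] := (diff_locallyP x f).1 df.
have /nbhs_normP[/= r r0 rE] := dfE _ e0; exists r => // k kr.
by apply: rE; rewrite /= sub0r normrN.
Qed.

Lemma approx_differentiable V W (f : V -> W) (L : {linear V -> W}) (x : V) :
  continuous L -> (forall e, 0 < e ->
    \forall y \near x, `|f y - (f x + L (y - x))| <= e * `|y - x|) ->
  differentiable f x /\ forall v, 'd f x v = L v.
Proof.
move=> Lc fE.
have gE : f \o shift x = cst (f x) + L +o_ 0 id.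
  apply/eqaddoP => e e0; have := fE e e0.
  rewrite (near_shift 0 x); apply: filterS => y /=.
  by rewrite subr0 addrK.
have dE := diff_unique Lc gE.
split; first by apply/diff_locallyP; rewrite dE.
by move=> v; rewrite dE.
Qed.

(** Expand [f] to first order at [g y] with increment [g y' - g y] and apply the inverse Jacobian.
    The error is small relative to this increment, hence relative to [y' - y] by the Lipschitz bound
    on [g]. *)
Lemma inverse_differentiable n (f g : 'rV[R]_n -> 'rV[R]_n) y C :
  0 < C -> 'J f (g y) \in unitmx -> differentiable f (g y) ->
  (\forall y' \near y, f (g y') = y') ->
  (\forall y' \near y, `|g y' - g y| <= C * `|y' - y|) ->
  differentiable g y /\ forall v, 'd g y v = v *m invmx ('J f (g y)).
Proof.
move=> C0; set x := g y; set A := 'J f x => Au df fg gl.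
have fx : f x = y := nbhs_singleton fg.
pose L : {linear 'rV[R]_n -> 'rV[R]_n} := mulmxr (invmx A).
have LE v : L v = v *m invmx A by [].
have Lc : continuous L := @linear_rV_continuous R n _ L.
have [C' C'0 LC'] := linear_lipschitz Lc.
apply: (@approx_differentiable _ _ g L) => // e e0.
have e'0 : 0 < e / (C' * C) by rewrite divr_gt0 ?mulr_gt0.
have [r r0 rE] := differentiable_approx df e'0.
have rC : 0 < r / C by rewrite divr_gt0.
have k0 : \forall y' \near y, `|y' - y| < r / C.
  by apply/nbhs_normP; exists (r / C) => // k /=; rewrite distrC.
apply: filterS3 fg gl k0 => y' fgy gly yr; rewrite -/x.
set h := g y' - x in gly.
have hx : h + x = g y' by rewrite /h subrK.
have hr : `|h| < r.
  by apply: le_lt_trans gly _; rewrite mulrC -ltr_pdivlMr.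
have := rE h hr; rewrite hx fgy fx -mul_jacobian -/A => hA.
have -> : g y' - (x + (y' - y) *m invmx A) = L (h *m A - (y' - y)).
  by rewrite LE [in RHS]mulmxBl mulmxK // -hx opprD addrA addrK.
apply: le_trans (LC' _) _.
have {}hA : `|h *m A - (y' - y)| <= e / (C' * C) * `|h|.
  have -> // : h *m A - (y' - y) = - (y' - (y + h *m A)).
    by rewrite !opprB addrA [_ + y]addrC.
  by rewrite normrN.
apply: le_trans (ler_wpM2l (ltW C'0) hA) _.
have h1 := ler_wpM2l (ltW e'0) gly.
apply: le_trans (ler_wpM2l (ltW C'0) h1) _.
rewrite le_eqVlt; apply/orP; left; apply/eqP; field.
by rewrite !gt_eqF.
Qed.

(** Bootstrapping: the derivative of [g] is the inverse Jacobian of [f] composed with [g], hence is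
    C^k as soon as [g] is. *)
Lemma inverse_smooth n (f g : 'rV[R]_n -> 'rV[R]_n) (V W : set 'rV[R]_n) C :
  0 < C -> open V -> open W -> smooth_on V f ->
  (forall x, V x -> 'J f x \in unitmx) -> (forall y, W y -> V (g y)) ->
  (forall y, W y -> f (g y) = y) ->
  (forall y y', W y -> W y' -> `|g y - g y'| <= C * `|y - y'|) ->
  smooth_on W g.
Proof.
move=> C0 oV oW fV fu gV fg gl.
have dg y : W y -> differentiable g y /\ forall v,
  'd g y v = v *m invmx ('J f (g y)).
  move=> Wy; have nW : \forall y' \near y, W y' := open_nbhs_nbhs (conj oW Wy).
  apply: (@inverse_differentiable _ f g y C) => //.
  - by apply: fu; exact: gV.
  - by apply: (fV 1%N).1; exact: gV.
  - by apply: filterS nW => y' /fg.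
  - by apply: filterS nW => y' Wy'; exact: gl.
elim=> [|k IH]; first by move=> y /dg[/differentiable_continuous].
split=> [y /dg[] //|v].
apply: (Ck_eq (f := fun y => v *m invmx ('J f (g y)))) => //.
  by move=> y /dg[dgy dE]; rewrite deriveE.
apply/(Ck_rowP _ _ oW) => j.
pose B y := invmx ('J f (g y)).
apply: (Ck_eq (f := fun y => \sum_i v ord0 i * B y i j)) => //.
  by move=> y _; rewrite mxE.
apply: Ck_sum => // i; apply: CkM => //; first exact: Ck_cst.
apply: Ck_invmx => // [y /gV/fu //|{}i {}j].
apply: (Ck_eq (f := (fun x => 'D_(delta_mx ord0 i) f x ord0 j) \o g)) => //.
  move=> y Wy; have dfy : differentiable f (g y) by apply: (fV 1%N).1; exact: gV.
  by rewrite /= deriveE // -mul_jacobian -rowE mxE.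
apply: Ck_comp_scalar IH _ => //; first exact: gV.
exact: ((Ck_rowP k _ oV).1 ((fV k.+1).2 _)).
Qed.

Lemma diff_id_sub V W (L : {linear W -> V}) (f : V -> W) x : continuous L ->
  differentiable f x -> forall v, 'd (fun y => y - L (f y)) x v = v - L ('d f x v).
Proof.
move=> Lc df v; have [dL dLE] := diff_comp_lin Lc df.
have di := @ex_diff _ _ _ _ _ _ _ (is_diff_id x).
rewrite (diffB di dL) diff_val; apply: etrans (_ : v - 'd (L \o f) x v = _) => //.
by rewrite dLE.
Qed.

(** With [B] the inverse Jacobian at [x0], the map [h x = x - f x *m B] has zero differential at
    [x0], hence is a contraction of ratio 1/2 on a small ball. Solving [f x = y] amounts to solving
    [x - h x = y *m B]. *)
Theorem inverse_function n (f : 'rV[R]_n -> 'rV[R]_n) x0 (N : set 'rV[R]_n) :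
  nbhs x0 N -> smooth_at f x0 -> (forall v, 'd f x0 v = 0 -> v = 0) ->
  exists (V W : set 'rV[R]_n) (g : 'rV[R]_n -> 'rV[R]_n),
    [/\ open V, V x0, V `<=` N & open W] /\
    [/\ forall x, V x -> W (f x) /\ g (f x) = x,
        forall y, W y -> V (g y) /\ f (g y) = y,
        smooth_on V f & smooth_on W g].
Proof.
move=> x0N fx0 df_inj; pose A := 'J f x0; pose B := invmx A.
have Au : A \in unitmx.
  by apply: injective_unitmx => v; rewrite mul_jacobian; exact: df_inj.
have mulB_inj (u v : 'rV[R]_n) : u *m B = v *m B -> u = v.
  by move=> /(congr1 (mulmx ^~ A)); rewrite !mulmxKV.
pose h x := x - f x *m B.
have hE x : x - h x = f x *m B by rewrite /h subKr.
have hs x : smooth_at f x -> smooth_at h x.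
  move=> fx; apply: (@smooth_atB _ _ _ id); first exact: smooth_at_id.
  exact: smooth_at_mulmx.
have dh x : differentiable f x -> forall v, 'd h x v = v - 'd f x v *m B.
  pose L : {linear 'rV[R]_n -> 'rV[R]_n} := mulmxr B.
  have Lc : continuous L := @linear_rV_continuous R n _ L.
  move=> fx.
  exact: (diff_id_sub Lc fx).
have h0 : 'd h x0 = 0 :> (_ -> _).
  apply/funext => v; rewrite dh; last exact: smooth_at_differentiable.
  by rewrite -mul_jacobian mulmxK // subrr.
have half0 : 0 < 2^-1 :> R by rewrite invr_gt0.
have /nbhs_ballP[r /= r0 rP] : \forall x \near x0, [/\ N x, smooth_at f x &
    forall w, `|'d h x w| <= 2^-1 * `|w|].
  have := small_diff_near half0 (hs _ fx0) h0.
  by apply: filterS3 x0N (near_smooth_at fx0) => x.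
have rf x : ball x0 r x -> smooth_at f x by move=> /rP[].
have dhr x : ball x0 r x -> differentiable h x.
  by move=> /rf/hs; exact: smooth_at_differentiable.
have hl x x' : ball x0 r x -> ball x0 r x' -> `|h x - h x'| <= 2^-1 * `|x - x'|.
  apply: (mean_value_ball (ltW half0) dhr) => y bry; have [_ _] := rP _ bry; exact.
have r2 x : ball x0 (r / 2) x -> ball x0 r x.
  by apply: le_ball; rewrite ler_pdivrMr // ler_pMr // ler1n.
have [C C0 LC] : exists2 C, 0 < C & forall u : 'rV[R]_n, `|u *m B| <= C * `|u|.
  pose L : {linear 'rV[R]_n -> 'rV[R]_n} := mulmxr B.
  exact: (linear_lipschitz (@linear_rV_continuous R n _ L)).
(* Since [h] halves distances, [x - h x] at least halves them. This one bound gives injectivity of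
   [f] and the Lipschitz constant of its inverse. *)
have f_lower x x' : ball x0 r x -> ball x0 r x' ->
    `|x - x'| <= (2 * C) * `|f x - f x'|.
  move=> bx bx'; have := hl _ _ bx bx'.
  have := LC (f x - f x'); rewrite mulmxBl -!hE.
  have -> : x - h x - (x' - h x') = (x - x') - (h x - h x').
    by rewrite !opprD !opprK addrACA.
  have := lerB_dist (x - x') (h x - h x'); rewrite -mulrA; lra.
(* [W] is the set of values for which [perturbed_id_surj] finds a solution; that solution lies in
   the ball of radius [r / 2], whence [V]. *)
pose W : set 'rV[R]_n := [set y | `|y *m B - (x0 - h x0)| < r / 10].
pose V : set 'rV[R]_n := ball x0 (r / 2) `&` f @^-1` W.
pose g y := xget x0 [set x | ball x0 (r / 2) x /\ f x = y].
have gP y : W y -> ball x0 (r / 2) (g y) /\ f (g y) = y.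
  move=> Wy; apply: (xgetPex x0 (P := [set x | ball x0 (r / 2) x /\ f x = y])).
  have hc x : ball x0 r x -> {for x, continuous h}.
    by move=> /dhr; exact: differentiable_continuous.
  have [x bx xE] := perturbed_id_surj r0 hc hl Wy.
  by exists x; split=> //; apply: mulB_inj; rewrite -hE.
have mulBc : continuous (fun y : 'rV[R]_n => y *m B).
  move=> y; exact: smooth_at_continuous (smooth_at_mulmx B (smooth_at_id y)).
have oW : open W.
  have -> : W = (fun y => y *m B) @^-1` ball (x0 - h x0) (r / 10).
    by apply/seteqP; split=> y; rewrite /W -ball_normE /= distrC.
  by apply: open_comp; [move=> y _; exact: mulBc|exact: ball_open].
have oV : open V.
  rewrite openE => x [bx Wfx]; rewrite /interior.
  have n1 : \forall x' \near x, ball x0 (r / 2) x'.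
    by apply: open_nbhs_nbhs; split=> //; exact: ball_open.
  have n2 : \forall x' \near x, W (f x').
    have := smooth_at_continuous (rf _ (r2 _ bx)).
    by apply; exact: open_nbhs_nbhs.
  by apply: filterS2 n1 n2 => x'; split.
have Vf : smooth_on V f.
  by apply: smooth_at_on => x [/r2/rf].
have r20 : 0 < r / 2 by rewrite divr_gt0.
exists V, W, g; split; split => //.
- split; first exact: ballxx.
  by rewrite /W /= hE subrr normr0 divr_gt0.
- by move=> x [/r2/rP[]].
- move=> x [bx Wfx]; split=> //; have [bg fg] := gP _ Wfx.
  apply/eqP; rewrite -subr_eq0 -normr_le0.
  have := f_lower _ _ (r2 _ bg) (r2 _ bx).
  by rewrite fg subrr normr0 mulr0.
- by move=> y Wy; have [bg fg] := gP _ Wy; split=> //; split=> //=;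
    rewrite /preimage /= fg.
have VW y : W y -> V (g y).
  by move=> Wy; have [bg fg] := gP _ Wy; split=> //=; rewrite /preimage /= fg.
(* A vector killed by ['d f x] is fixed by ['d h x], which at least halves norms, so it is zero. *)
have fu x : V x -> 'J f x \in unitmx.
  move=> [/r2 bx _]; apply: injective_unitmx => v; rewrite mul_jacobian => dv0.
  have [_ _ /(_ v)] := rP _ bx.
  rewrite dh ?dv0 ?mul0mx ?subr0; last exact: smooth_at_differentiable (rf _ bx).
  move=> hv; apply/eqP; rewrite -normr_le0; move: hv; lra.
have fgW y : W y -> f (g y) = y by move=> /gP[].
have gl y y' : W y -> W y' -> `|g y - g y'| <= (2 * C) * `|y - y'|.
  move=> /gP[bg fg] /gP[bg' fg'].
  by have := f_lower _ _ (r2 _ bg) (r2 _ bg'); rewrite fg fg'.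
have C20 : 0 < 2 * C by rewrite mulr_gt0.
exact: (inverse_smooth C20 oV oW Vf fu VW fgW gl).
Qed.

End InverseFunction.

(** * Plots, curves and charts *)

Section Plots.
Context {R : realType}.
Implicit Types V W : normedModType R.

Lemma near_comp (T T' : topologicalType) (p : T -> T') u (P : set T') :
  {for u, continuous p} -> (\forall y \near p u, P y) -> \forall v \near u, P (p v).
Proof. by move=> pc; exact: pc. Qed.

(* Smoothness of p near u, read in the distinguished chart at p u.  Smooth maps
   between manifolds are handled through their action on such plots, which are
   parametrized by any normed space: V = R for curves, V = 'rV_m for inverses of
   charts. *)
Definition plot m (M : manifold R m) V (p : V -> M) (u : V) :=
  {for u, continuous p} /\ smooth_at (fun v => cmap (chart_at (p u)) (p v)) u.

Lemma chart_at_compatible m (M : manifold R m) (x : M) :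
  compatible_chart (chart_at x).
Proof. by move=> y; split; exact: chart_at_compat. Qed.

Lemma near_cdom T m (c : chart R T m) x : cdom c x -> \forall y \near x, cdom c y.
Proof. by move=> cx; apply: open_nbhs_nbhs; split=> //; exact: cdom_open. Qed.

Lemma near_cimg T m (c : chart R T m) u : cimg c u -> \forall v \near u, cimg c v.
Proof. by move=> cu; apply: open_nbhs_nbhs; split=> //; exact: cimg_open. Qed.

Lemma cimg_cmap T m (c : chart R T m) x : cdom c x -> cimg c (cmap c x).
Proof. by exists x. Qed.

Lemma cdom_cinv T m (c : chart R T m) u : cimg c u -> cdom c (cinv c u).
Proof. by move=> [x cx <-]; rewrite cmapK. Qed.

Lemma cinvK T m (c : chart R T m) u : cimg c u -> cmap c (cinv c u) = u.
Proof. by move=> [x cx <-]; rewrite cmapK. Qed.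

Lemma transition_smooth_at T m (c c' : chart R T m) u :
  smooth_transition c c' -> cimg c u -> cdom c' (cinv c u) ->
  smooth_at (cmap c' \o cinv c) u.
Proof. by move=> cc cu c'u; apply: smooth_on_at cc _ => //;
  exact: overlap_open. Qed.

Lemma near_eq_plot m (M : manifold R m) V (p q : V -> M) u :
  (\near u, p u = q u) -> plot p u -> plot q u.
Proof.
move=> pq [pc ps]; split; first exact: near_eq_continuous pq pc.
apply: near_eq_smooth_at ps; rewrite (nbhs_singleton pq).
by apply: filterS pq => v ->.
Qed.

Lemma plot_chart m (M : manifold R m) V (p : V -> M) u (c : chart R M m) :
  compatible_chart c -> plot p u -> cdom c (p u) ->
  smooth_at (fun v => cmap c (p v)) u.
Proof.
move=> cc [pc ps] cu; have [_ tc] := cc (p u).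
set c0 := chart_at (p u) in ps tc.
have c0u : cdom c0 (p u) := mem_chart_at (p u).
have ts : smooth_at (cmap c \o cinv c0) (cmap c0 (p u)).
  by apply: transition_smooth_at; [|exact: cimg_cmap|rewrite cmapK].
have := smooth_at_comp ps ts; apply: near_eq_smooth_at.
have := near_comp pc (near_cdom c0u); apply: filterS => v /= c0v.
by rewrite /= cmapK.
Qed.

(** Continuity is asked separately because [cmap c] has arbitrary values off [cdom c]: smooth
    coordinates alone would not keep [p v] close to [p u]. *)
Lemma chart_plot m (M : manifold R m) V (p : V -> M) u (c : chart R M m) :
  compatible_chart c -> {for u, continuous p} -> cdom c (p u) ->
  smooth_at (fun v => cmap c (p v)) u -> plot p u.
Proof.
move=> cc pc cu ps; split=> //; have [tc _] := cc (p u).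
set c0 := chart_at (p u) in tc *.
have ts : smooth_at (cmap c0 \o cinv c) (cmap c (p u)).
  apply: transition_smooth_at => //; first exact: cimg_cmap.
  by rewrite cmapK //; exact: mem_chart_at.
have := smooth_at_comp ps ts; apply: near_eq_smooth_at.
have := near_comp pc (near_cdom cu); apply: filterS => v /= c0v.
by rewrite /= cmapK.
Qed.

Lemma plot_cinv m (M : manifold R m) (c : chart R M m) u :
  compatible_chart c -> cimg c u -> plot (cinv c) u.
Proof.
move=> cc cu; apply: (chart_plot cc); first exact: cinv_continuous.
  exact: cdom_cinv.
apply: near_eq_smooth_at (smooth_at_id u).
by apply: filterS (near_cimg cu) => v /cinvK.
Qed.

Lemma plot_comp m (M : manifold R m) V n (q : V -> 'rV[R]_n)
    (p : 'rV[R]_n -> M) u :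
  smooth_at q u -> plot p (q u) -> plot (p \o q) u.
Proof.
move=> qs [pc ps]; split; last exact: (smooth_at_comp qs ps).
by apply: continuous_comp => //; exact: smooth_at_continuous.
Qed.

Lemma plot_map m k (M : manifold R m) (N : manifold R k) (A : set M)
    (f : M -> N) V (p : V -> M) u :
  smooth_map_on A f -> (\forall v \near u, A (p v)) -> plot p u ->
  plot (f \o p) u.
Proof.
move=> fs nA [pc ps]; have [U [g [oU Uu gU gE]]] := fs _ (nbhs_singleton nA).
set c := chart_at (p u) in ps Uu gE; set c' := chart_at (f (p u)) in gE.
have gs : smooth_at g (cmap c (p u)) by exact: smooth_on_at gU _.
have gps := smooth_at_comp ps gs.
have nU : \forall v \near u, U (cmap c (p v)).
  by apply: (near_comp (smooth_at_continuous ps)); exact: open_nbhs_nbhs.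
have nc := near_comp pc (near_cdom (mem_chart_at (p u))).
have nE : \forall v \near u,
  cdom c' (f (p v)) /\ cmap c' (f (p v)) = g (cmap c (p v)).
  by apply: filterS3 nA nc nU => v Av cv Uv; exact: gE.
have c'u : cdom c' (f (p u)) := mem_chart_at _.
apply: (chart_plot (chart_at_compatible (f (p u)))) => //.
  have hc : {for u, continuous (cinv c' \o (g \o (fun v => cmap c (p v))))}.
    apply: continuous_comp; first exact: smooth_at_continuous gps.
    rewrite /= -(nbhs_singleton nE).2; apply: cinv_continuous.
    exact: cimg_cmap.
  apply: near_eq_continuous hc.
  by apply: filterS nE => v [c'v /= <-]; rewrite cmapK.
apply: near_eq_smooth_at gps.
by apply: filterS nE => v [_ ->].
Qed.

Lemma smooth_map_plot m k (M : manifold R m) (N : manifold R k) (f : M -> N)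
    V (p : V -> M) u :
  smooth_map f -> plot p u -> plot (f \o p) u.
Proof. by move=> fs; apply: plot_map fs _; near=> v.
Unshelve. all: by end_near. Qed.

(** A sufficient criterion: it requires smoothness on a full neighbourhood of each point of [A], as
    is available when [A] is open or when [f] is smooth everywhere. *)
Lemma plot_smooth_map_on m k (M : manifold R m) (N : manifold R k) (A : set M)
    (f : M -> N) :
  (forall x, A x -> plot (f \o cinv (chart_at x)) (cmap (chart_at x) x)) ->
  smooth_map_on A f.
Proof.
move=> fp x Ax; have [pc ps] := fp x Ax; set c := chart_at x in pc ps *.
have cx : cinv c (cmap c x) = x by rewrite cmapK //; exact: mem_chart_at.
rewrite /= cx in ps.
have nd : \forall u \near cmap c x, cdom (chart_at (f x)) (f (cinv c u)).
  by apply: (near_comp pc); rewrite /= cx; apply: near_cdom; exact: mem_chart_at.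
have [U [oU Ux UP]] := near_open (filterI nd (near_smooth_at ps)).
exists U, (fun u => cmap (chart_at (f x)) (f (cinv c u))); split=> //.
  by apply: smooth_at_on => u /UP[].
by move=> y Ay cy /UP[+ _]; rewrite /= cmapK.
Qed.

(** It suffices to compare [c], at each of its points, with the distinguished chart of that point;
    the atlas supplies the other transitions. *)
Lemma compatible_plot m (M : manifold R m) (c : chart R M m) :
  (forall u, cimg c u -> plot (cinv c) u) ->
  (forall x, cdom c x ->
    smooth_at (cmap c \o cinv (chart_at x)) (cmap (chart_at x) x)) ->
  compatible_chart c.
Proof.
move=> ci cs y; split.
  apply: smooth_at_on => u [cu yu].
  exact: plot_chart (chart_at_compatible y) (ci u cu) yu.
apply: smooth_at_on => u [yu cu]; set x := cinv (chart_at y) u in cu.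
have tx : smooth_at (cmap (chart_at x) \o cinv (chart_at y)) u.
  apply: transition_smooth_at => //; first exact: chart_at_compat.
  exact: mem_chart_at.
have := smooth_at_comp tx (cs x cu); apply: near_eq_smooth_at.
have yc := cinv_continuous yu.
have := near_comp yc (near_cdom (mem_chart_at x)); apply: filterS => v /= xv.
by rewrite /= cmapK.
Qed.

Lemma plot_pair m k (M : manifold R m) (N : manifold R k) V (p : V -> M)
    (q : V -> N) u : plot p u -> plot q u ->
  @plot _ (prod_manifold M N) V (fun v => (p v, q v)) u.
Proof.
move=> [pc ps] [qc qs]; split; first exact: (cvg_pair pc qc).
exact: (smooth_at_row_mx ps qs).
Qed.

Lemma plot_fst m k (M : manifold R m) (N : manifold R k) V
    (p : V -> prod_manifold M N) u : plot p u -> plot (fun v => (p v).1) u.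
Proof.
move=> [pc ps]; split; first by apply: (continuous_comp pc); exact: cvg_fst.
have := smooth_at_lsubmx ps.
by congr smooth_at; apply/funext => v; rewrite /= row_mxKl.
Qed.

Lemma plot_snd m k (M : manifold R m) (N : manifold R k) V
    (p : V -> prod_manifold M N) u : plot p u -> plot (fun v => (p v).2) u.
Proof.
move=> [pc ps]; split; first by apply: (continuous_comp pc); exact: cvg_snd.
have := smooth_at_rsubmx ps.
by congr smooth_at; apply/funext => v; rewrite /= row_mxKr.
Qed.

Lemma plot_cst m (M : manifold R m) V (x : M) (u : V) : plot (fun _ : V => x) u.
Proof. by split; [exact: cst_continuous|exact: smooth_at_cst]. Qed.

End Plots.

(** * Curves, velocities and differentials *)

Section Curves.
Context {R : realType}.
Implicit Types V W : normedModType R.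

Definition curve m (M : manifold R m) (c : R -> M) (x : M) (v : 'rV[R]_m) :=
  [/\ plot c 0, c 0 = x & 'D_1 (fun t => cmap (chart_at x) (c t)) 0 = v].

Lemma curve_smooth m (M : manifold R m) (c : R -> M) x v : curve c x v ->
  smooth_at (fun t => cmap (chart_at x) (c t)) 0.
Proof. by move=> [[_ cs] <-]. Qed.

(** Trades the explicit interval in [tangent] for a germ at 0, so that curves can be shrunk,
    composed and paired freely. *)
Lemma tangentP m (M : manifold R m) (Z : set M) z v : tangent Z z v <->
  exists c : R -> M, curve c z v /\ \forall t \near 0, Z (c t).
Proof.
split=> [[c [e e0 [c0 cZ cs cv]]]|[c [[cp c0 cv] cZ]]].
  pose B := [set t : R | `|t| < e].
  have BE : B = ball 0 e by apply/seteqP; split=> t;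
    rewrite -ball_normE /= sub0r normrN.
  have oB : open B by rewrite BE; exact: ball_open.
  have B0 : B 0 by rewrite /B /= normr0.
  have nB : \forall t \near (0 : R), B t by exact: open_nbhs_nbhs.
  exists c; split; last by apply: filterS nB => t /cZ[].
  split=> //; apply: (chart_plot (chart_at_compatible z)); last first.
  - exact: smooth_on_at cs _.
  - by rewrite c0; exact: mem_chart_at.
  have s0 : smooth_at (fun t => cmap (chart_at z) (c t)) 0
    by exact: smooth_on_at cs _.
  have hc : {for (0 : R),
    continuous (cinv (chart_at z) \o (fun t => cmap (chart_at z) (c t)))}.
    apply: continuous_comp; first exact: smooth_at_continuous s0.
    by apply: cinv_continuous; rewrite /= c0; exact/cimg_cmap/mem_chart_at.
  apply: near_eq_continuous hc.
  by apply: filterS nB => t /cZ[_ zt] /=; rewrite cmapK.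
have zc : \forall t \near (0 : R), cdom (chart_at z) (c t).
  by apply: (near_comp cp.1); rewrite c0; exact/near_cdom/mem_chart_at.
have cs : smooth_at (fun t => cmap (chart_at z) (c t)) 0.
  by rewrite -c0; exact: cp.2.
have nP : nbhs (0 : R) [set t | (Z (c t) /\ cdom (chart_at z) (c t)) /\
    smooth_at (fun t => cmap (chart_at z) (c t)) t].
  exact: filterI (filterI cZ zc) (near_smooth_at cs).
have [e /= e0 eP] := (nbhs_ballP _ _).1 nP.
have be t : `|t| < e -> ball (0 : R) e t by rewrite -ball_normE /= sub0r normrN.
exists c, e => //; split=> // [t /be/eP[[]] //|].
by apply: smooth_at_on => t /be/eP[].
Qed.

Lemma tangent_curve m (M : manifold R m) (Z : set M) z v c :
  curve c z v -> (\forall t \near 0, Z (c t)) -> tangent Z z v.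
Proof. by move=> cz cZ; apply/tangentP; exists c. Qed.

Lemma near_eq_curve m (M : manifold R m) (c c' : R -> M) x v :
  (\forall t \near 0, c t = c' t) -> curve c x v -> curve c' x v.
Proof.
move=> cc [cp c0 cv]; split; first exact: near_eq_plot cp.
  by rewrite -(nbhs_singleton cc).
rewrite -cv; apply: near_eq_derive.
by apply: filterS cc => t ->.
Qed.

Lemma curve_unique m (M : manifold R m) (c : R -> M) x v w :
  curve c x v -> curve c x w -> v = w.
Proof. by move=> [_ _ <-] [_ _ <-]. Qed.

Lemma curve_cst m (M : manifold R m) (x : M) : curve (fun _ => x) x 0.
Proof. by split; [exact: plot_cst| |rewrite derive_cst]. Qed.

Lemma chart_curve m (M : manifold R m) (c : chart R M m) (q : R -> 'rV[R]_m) x :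
  compatible_chart c -> cdom c x -> smooth_at q 0 -> q 0 = cmap c x ->
  curve (cinv c \o q) x
    ('d (cmap (chart_at x) \o cinv c) (cmap c x) ('D_1 q 0)).
Proof.
move=> cc cx qs q0; split.
- apply: plot_comp => //; rewrite q0; apply: plot_cinv => //.
  exact: cimg_cmap.
- by rewrite /= q0 cmapK.
have ts : smooth_at (cmap (chart_at x) \o cinv c) (cmap c x).
  apply: transition_smooth_at; [exact: (cc x).1|exact: cimg_cmap|].
  by rewrite cmapK //; exact: mem_chart_at.
rewrite -q0 -derive_diff_comp //; first exact: smooth_at_differentiable.
by rewrite q0; exact: smooth_at_differentiable.
Qed.

Lemma curve_exists m (M : manifold R m) x v : exists c : R -> M, curve c x v.
Proof.
pose q (t : R) := cmap (chart_at x) x + t *: v.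
have qs : smooth_at q 0.
  by apply: smooth_atD; [exact: smooth_at_cst|exact: smooth_at_scalel].
have q0 : q 0 = cmap (chart_at x) x by rewrite /q scale0r addr0.
have cx := mem_chart_at x.
exists (cinv (chart_at x) \o q).
have := chart_curve (chart_at_compatible x) cx qs q0.
rewrite (derive_line _ v 0).2.
have idE : \forall u \near cmap (chart_at x) x,
    id u = (cmap (chart_at x) \o cinv (chart_at x)) u.
  by apply: filterS (near_cimg (cimg_cmap cx)) => u xu /=; rewrite cinvK.
rewrite -deriveE; last first.
  exact/smooth_at_differentiable/(near_eq_smooth_at idE)/smooth_at_id.
by rewrite -(near_eq_derive v idE) derive_id.
Qed.

Lemma curve_chart m (M : manifold R m) (c : chart R M m) (p : R -> M) x v :
  compatible_chart c -> cdom c x -> curve p x v ->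
  'D_1 (fun t => cmap c (p t)) 0 =
    'd (cmap c \o cinv (chart_at x)) (cmap (chart_at x) x) v.
Proof.
move=> cc cx [pp p0 <-].
have ts : smooth_at (cmap c \o cinv (chart_at x)) (cmap (chart_at x) x).
  apply: transition_smooth_at; [exact: (cc x).2|exact/cimg_cmap/mem_chart_at|].
  by rewrite cmapK //; exact: mem_chart_at.
have ps : smooth_at (fun t => cmap (chart_at x) (p t)) 0.
  by rewrite -p0; exact: pp.2.
have -> : cmap (chart_at x) x = cmap (chart_at x) (p 0) by rewrite p0.
rewrite -derive_diff_comp; [|exact: smooth_at_differentiable|]; last first.
  by rewrite p0; exact: smooth_at_differentiable.
apply: near_eq_derive.
have : \forall t \near (0 : R), cdom (chart_at x) (p t).
  by apply: (near_comp pp.1); rewrite p0; exact/near_cdom/mem_chart_at.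
by apply: filterS => t xt /=; rewrite cmapK.
Qed.

Section Mdiff.
Context {m k : nat} {M : manifold R m} {N : manifold R k}.
Variables (f : M -> N) (fs : smooth_map f).

Lemma smooth_map_coord x :
  smooth_at (fun u => cmap (chart_at (f x)) (f (cinv (chart_at x) u)))
    (cmap (chart_at x) x).
Proof.
have xx := mem_chart_at x.
have := smooth_map_plot fs (plot_cinv (chart_at_compatible x) (cimg_cmap xx)).
by move=> [_]; rewrite /= cmapK.
Qed.

Lemma curve_map c x v : curve c x v -> curve (f \o c) (f x) (mdiff f x v).
Proof.
move=> [cp c0 cv]; split; [exact: smooth_map_plot|by rewrite /= c0|].
have fx := smooth_map_coord x.
have cs : smooth_at (fun t => cmap (chart_at x) (c t)) 0 by rewrite -c0;
  exact: cp.2.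
rewrite /mdiff -cv.
have E : cmap (chart_at x) x = cmap (chart_at x) (c 0) by rewrite c0.
rewrite E -derive_diff_comp; [|exact: smooth_at_differentiable|]; last first.
  by rewrite c0; exact: smooth_at_differentiable.
apply/esym/near_eq_derive.
have : \forall t \near (0 : R), cdom (chart_at x) (c t).
  by apply: (near_comp cp.1); rewrite c0; exact/near_cdom/mem_chart_at.
by apply: filterS => t xt /=; rewrite cmapK.
Qed.

Lemma tangent_map (Z : set M) (Z' : set N) x v : (forall z, Z z -> Z' (f z)) ->
  tangent Z x v -> tangent Z' (f x) (mdiff f x v).
Proof.
move=> ZZ /tangentP[c [cx cZ]]; apply: (tangent_curve (curve_map cx)).
by apply: filterS cZ => t /ZZ.
Qed.

End Mdiff.

Lemma mdiff_id_comp m k (M : manifold R m) (N : manifold R k)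
    (f : M -> N) (g : N -> M) x v : smooth_map f -> smooth_map g ->
  (forall y, g (f y) = y) -> mdiff g (f x) (mdiff f x v) = v.
Proof.
move=> fs gs gf; have [c cx] := curve_exists x v.
have := curve_map gs (curve_map fs cx).
rewrite gf; have -> : g \o (f \o c) = c by apply/funext => t /=; rewrite gf.
by move=> /curve_unique; apply.
Qed.

Lemma curve_pair m k (M : manifold R m) (N : manifold R k) (c : R -> M)
    (c' : R -> N) x y v w : curve c x v -> curve c' y w ->
  @curve _ (prod_manifold M N) (fun t => (c t, c' t)) (x, y) (row_mx v w).
Proof.
move=> cx c'y; have [cp c0 cv] := cx; have [c'p c'0 cw] := c'y.
split; [exact: plot_pair|by rewrite c0 c'0|].
have dc := smooth_at_differentiable (curve_smooth cx).
have dc' := smooth_at_differentiable (curve_smooth c'y).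
have [dr drE] := row_mx_differentiable dc dc'.
rewrite -[LHS]/('D_1 (fun t : R => row_mx (cmap (chart_at x) (c t))
  (cmap (chart_at y) (c' t))) 0) deriveE // drE -cv -cw.
by rewrite !deriveE.
Qed.

Lemma prod_curve m k (M : manifold R m) (N : manifold R k)
    (c : R -> prod_manifold M N) p v : curve c p v ->
  curve (fun t => (c t).1) p.1 (lsubmx v) /\
  curve (fun t => (c t).2) p.2 (rsubmx v).
Proof.
move=> cpv; have [cp c0 <-] := cpv.
have dc := smooth_at_differentiable (curve_smooth cpv).
split; split; rewrite ?c0 //; [exact: plot_fst| |exact: plot_snd|].
  have -> : (fun t => cmap (chart_at p.1) (c t).1) =
      (fun t => cmap (chart_at p) (c t) *m col_mx 1%:M 0).
    by apply/funext => t; rewrite mulmx_lsubmx /= row_mxKl.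
  by rewrite (derive_mulmx _ _ dc) mulmx_lsubmx.
have -> : (fun t => cmap (chart_at p.2) (c t).2) =
    (fun t => cmap (chart_at p) (c t) *m col_mx 0 1%:M).
  by apply/funext => t; rewrite mulmx_rsubmx /= row_mxKr.
by rewrite (derive_mulmx _ _ dc) mulmx_rsubmx.
Qed.

End Curves.

(** * Lifting curves through submersions *)

Section Lift.
Context {R : realType}.
Implicit Types V W : normedModType R.

Lemma derive_add V W (f g : V -> W) (x v : V) :
  differentiable f x -> differentiable g x ->
  'D_v (fun y => f y + g y) x = 'D_v f x + 'D_v g x.
Proof. by move=> df dg; rewrite -deriveD //; exact: diff_derivable. Qed.

Lemma diff_lin_sub V W (L : {linear V -> W}) (f : V -> W) x : continuous L ->
  differentiable f x -> forall v, 'd (fun y => L y - f y) x v = L v - 'd f x v.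
Proof.
move=> Lc df v; have dL := @linear_differentiable _ _ _ L x Lc.
rewrite (diffB dL df); apply: etrans (_ : 'd L x v - 'd f x v = _) => //.
by rewrite (diff_lin _ Lc).
Qed.

Lemma lift_coord m d (F : 'rV[R]_m -> 'rV[R]_d) x0 (y : R -> 'rV[R]_d) v :
  smooth_at F x0 -> (forall w, exists v, 'd F x0 v = w) ->
  smooth_at y 0 -> y 0 = F x0 -> 'd F x0 v = 'D_1 y 0 ->
  exists c : R -> 'rV[R]_m, [/\ smooth_at c 0, c 0 = x0, 'D_1 c 0 = v &
    \forall t \near 0, F (c t) = y t].
Proof.
move=> Fs Fsurj ys y0 Fv; pose J := 'J F x0.
have Jfull : row_full J.
  rewrite -sub1mx; apply/row_subP => i; have [u uE] := Fsurj (row i 1%:M).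
  by rewrite -uE -mul_jacobian submxMl.
pose K := pinvmx J; have KJ : K *m J = 1%:M := mulVpmx Jfull.
pose LJ : {linear 'rV[R]_m -> 'rV[R]_d} := mulmxr J.
pose LK : {linear 'rV[R]_d -> 'rV[R]_m} := mulmxr K.
have LJc : continuous LJ := @linear_rV_continuous R m _ LJ.
have LKc : continuous LK := @linear_rV_continuous R d _ LK.
(* Phi below has differential 1 at x0 and satisfies Phi x *m J = F x, so that F
   is linear in the coordinates Phi. *)
pose h x := LJ x - F x.
have hs : smooth_at h x0.
  exact: (smooth_atB (smooth_at_linear LJc (smooth_at_id x0)) Fs).
have dh u : 'd h x0 u = 0.
  rewrite diff_lin_sub //; last exact: smooth_at_differentiable.
  by rewrite -mul_jacobian /= subrr.
pose Phi x := x - LK (h x).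
have Phis : smooth_at Phi x0.
  by apply: (@smooth_atB _ _ _ id); [exact: smooth_at_id|exact: smooth_at_linear].
have dPhi u : 'd Phi x0 u = u.
  apply: etrans (diff_id_sub LKc (smooth_at_differentiable hs) u) _.
  by rewrite dh linear0 subr0.
have PhiJ x : Phi x *m J = F x.
  by rewrite mulmxBl /= -mulmxA KJ mulmx1 /h /= subKr.
have Phi_inj u : 'd Phi x0 u = 0 -> u = 0 by rewrite dPhi.
have [V [W [g [[oV Vx0 _ oW] [VW WV Vs Ws]]]]] :=
  inverse_function (filterT : nbhs x0 setT) Phis Phi_inj.
(* In the coordinates [Phi] the map is multiplication by [J], with section [K]. This path satisfies
   [z t *m J = y t] and starts at [Phi x0]; the term along [v - v *m J *m K], which lies in the
   kernel of [J], corrects its initial velocity to [v]. *)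
pose z (t : R) := ((Phi x0 - LK (y 0)) + t *: (v - LK (LJ v))) + LK (y t).
have dys := smooth_at_differentiable ys.
have [dLy dLyE] := diff_comp_lin LKc dys.
have zs : smooth_at z 0.
  apply: smooth_atD; last exact: smooth_at_linear.
  by apply: smooth_atD; [exact: smooth_at_cst|exact: smooth_at_scalel].
have z0 : z 0 = Phi x0 by rewrite /z scale0r addr0 subrK.
have dz : 'D_1 z 0 = v.
  have [dl dlE] := derive_line (Phi x0 - LK (y 0)) (v - LK (LJ v)) (0 : R).
  rewrite (derive_add _ dl dLy) dlE deriveE // dLyE -deriveE // -Fv.
  by rewrite -mul_jacobian subrK.
have [Wz0 gz0] := VW _ Vx0.
have gs : smooth_at g (z 0) by apply: smooth_on_at Ws _ => //; rewrite z0.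
have nW : \forall t \near (0 : R), W (z t).
  apply: (near_comp (smooth_at_continuous zs)); rewrite z0.
  exact: open_nbhs_nbhs.
exists (g \o z); split.
- exact: smooth_at_comp zs gs.
- by rewrite /= z0.
- have gz : g (z 0) = x0 by rewrite z0.
  have dg := smooth_at_differentiable gs.
  have dP : differentiable Phi (g (z 0)) by rewrite gz;
    exact: smooth_at_differentiable.
  rewrite derive_diff_comp ?dz; [|exact: smooth_at_differentiable|exact: dg].
  rewrite -(deriveE v dg) -[LHS]dPhi -gz -(derive_diff_comp v dg dP).
  rewrite -[RHS](derive_id (z 0) v); apply: near_eq_derive.
  rewrite z0; have : \forall w \near Phi x0, W w by exact: open_nbhs_nbhs.
  by apply: filterS => w /WV[].
apply: filterS nW => t Wzt; rewrite -PhiJ /=; have [_ ->] := WV _ Wzt.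
have KJE w : LK w *m J = w by rewrite /= -mulmxA KJ mulmx1.
rewrite /z mulmxDl KJE mulmxDl [(_ - LK _) *m J]mulmxBl PhiJ KJE.
by rewrite -scalemxAl mulmxBl KJE subrr scaler0 addr0 y0 subrr add0r.
Qed.

(** The initial velocity [v] of the lift can be prescribed, subject to the evident compatibility.
    Applied to [grng] and [gsrc], this turns infinitesimally composable pairs of vectors into
    velocities of curves of composable pairs. *)
Lemma lift_curve m d (M : manifold R m) (N : manifold R d) (f : M -> N) x
    (y : R -> N) v : submersion f -> curve y (f x) (mdiff f x v) ->
  exists c, curve c x v /\ \forall t \near 0, f (c t) = y t.
Proof.
move=> [fs fsurj] yc; have ys := curve_smooth yc; have [yp y0 yv] := yc.
set cx := chart_at x; set cy := chart_at (f x) in ys *.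
have fx := smooth_map_coord fs x.
have E : cinv cx (cmap cx x) = x by rewrite cmapK //; exact: mem_chart_at.
have [||q [qs q0 qv qE]] := lift_coord (v := v) fx (fsurj x) ys.
- by rewrite y0 E.
- by rewrite yv.
have := chart_curve (chart_at_compatible x) (mem_chart_at x) qs q0.
exists (cinv cx \o q); split.
  have xx := mem_chart_at x.
  split=> //.
  - by apply: plot_comp => //; rewrite q0; apply: plot_cinv;
      [exact: chart_at_compatible|exact: cimg_cmap].
  - by rewrite /= q0.
  rewrite -qv; apply: near_eq_derive.
  have : \forall t \near (0 : R), cimg cx (q t).
    apply: (near_comp (smooth_at_continuous qs)); rewrite q0.
    exact/near_cimg/cimg_cmap.
  by apply: filterS => t qt /=; rewrite cinvK.
have n1 : \forall t \near (0 : R), cdom cy (y t).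
  by apply: (near_comp yp.1); rewrite y0; exact/near_cdom/mem_chart_at.
have n2 : \forall t \near (0 : R), cdom cy (f (cinv cx (q t))).
  have fp := smooth_map_plot fs
    (plot_cinv (chart_at_compatible x) (cimg_cmap (mem_chart_at x))).
  apply: (near_comp (p := q) (P := fun u => cdom cy (f (cinv cx u)))).
    exact: smooth_at_continuous.
  rewrite q0; apply: (near_comp fp.1); rewrite /= E.
  exact/near_cdom/mem_chart_at.
apply: filterS3 qE n1 n2 => t qt yt fqt /=.
by rewrite -(cmapK yt) -qt cmapK.
Qed.

End Lift.

(** * New charts: composition, restriction, transport, products *)

Section Charts.
Context {R : realType}.
Implicit Types V W : normedModType R.

Lemma smooth_map_continuous m k (M : manifold R m) (N : manifold R k)
    (A : set M) (f : M -> N) x : open A -> smooth_map_on A f -> A x ->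
  {for x, continuous f}.
Proof.
move=> oA fs Ax; set c := chart_at x; have cx : cdom c x := mem_chart_at x.
have E : cinv c (cmap c x) = x by rewrite cmapK.
have ip := plot_cinv (chart_at_compatible x) (cimg_cmap cx).
have [fc _] : plot (f \o cinv c) (cmap c x).
  apply: (plot_map fs _ ip); apply: (near_comp ip.1); rewrite E.
  exact: open_nbhs_nbhs.
have hc : {for x, continuous ((f \o cinv c) \o cmap c)}.
  by apply: continuous_comp fc; exact: cmap_continuous.
apply: near_eq_continuous hc.
by apply: filterS (near_cdom cx) => y cy /=; rewrite cmapK.
Qed.

Section Compose.
Context {m : nat} (M : manifold R m) (c : chart R M m).
Variables (D D' : set 'rV[R]_m) (Th Th' : 'rV[R]_m -> 'rV[R]_m).
Hypotheses (cc : compatible_chart c) (oD : open D) (oD' : open D').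
Hypotheses (ThD : forall u, D u -> D' (Th u)) (ThD' : forall u, D' u -> D (Th' u)).
Hypotheses (ThK : forall u, D u -> Th' (Th u) = u).
Hypotheses (ThK' : forall u, D' u -> Th (Th' u) = u).
Hypotheses (Ths : smooth_on D Th) (Ths' : smooth_on D' Th').

Let dom : set M := [set x | cdom c x /\ D (cmap c x)].
Let map x := Th (cmap c x).
Let inv u := cinv c (Th' u).

Let dom_near x : dom x -> nbhs x dom.
Proof.
move=> [cx Dx]; have nc := near_cdom cx.
have nD : \forall y \near x, D (cmap c y).
  by apply: (near_comp (cmap_continuous cx)); exact: open_nbhs_nbhs.
by apply: filterS2 nc nD => y; split.
Qed.

Let imgE : map @` dom = [set u | D' u /\ cimg c (Th' u)].
Proof.
apply/seteqP; split=> [_ [x [cx Dx] <-]|u [D'u [x cx xu]]] /=.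
  by rewrite /map ThK //; split; [exact: ThD|exact: cimg_cmap].
by exists x; [split=> //; rewrite xu; exact: ThD'|rewrite /map xu ThK'].
Qed.

Let Th'_smooth u : D' u -> smooth_at Th' u.
Proof. by move=> D'u; exact: smooth_on_at Ths' _. Qed.

Let Th_smooth u : D u -> smooth_at Th u.
Proof. by move=> Du; exact: smooth_on_at Ths _. Qed.

Let img_near u : (map @` dom) u -> nbhs u (map @` dom).
Proof.
rewrite imgE => -[D'u cu].
have nD : \forall v \near u, D' v by exact: open_nbhs_nbhs.
have nc := near_comp (smooth_at_continuous (Th'_smooth D'u)) (near_cimg cu).
by apply: filterS2 nD nc => v; split.
Qed.

Let dom_open : open dom.
Proof. by rewrite openE => x; exact: dom_near. Qed.

Let img_open : open (map @` dom).
Proof. by rewrite openE => x; exact: img_near. Qed.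

Let map_continuous x : dom x -> {for x, continuous map}.
Proof.
move=> [cx Dx]; apply: continuous_comp; first exact: cmap_continuous.
exact: smooth_at_continuous (Th_smooth Dx).
Qed.

Let inv_continuous u : (map @` dom) u -> {for u, continuous inv}.
Proof.
rewrite imgE => -[D'u cu]; apply: continuous_comp.
  exact: smooth_at_continuous (Th'_smooth D'u).
exact: cinv_continuous.
Qed.

Let mapK x : dom x -> inv (map x) = x.
Proof. by move=> [cx Dx]; rewrite /inv /map ThK // cmapK. Qed.

(** A chart followed by a diffeomorphism [Th] between open sets is again a chart. The identity of a
    smaller open set yields restrictions, and a shear straightens graphs. *)
Lemma compose_chart : exists c' : chart R M m, [/\ compatible_chart c',
  forall x, cdom c' x <-> cdom c x /\ D (cmap c x) &
  forall x, cmap c' x = Th (cmap c x)].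
Proof.
pose c' := Chart dom_open img_open map_continuous inv_continuous mapK.
exists c'; split=> //; apply: compatible_plot.
  have cE : cimg c' = [set u | D' u /\ cimg c (Th' u)] := imgE.
  move=> u; rewrite cE => -[D'u cu].
  exact: plot_comp (Th'_smooth D'u) (plot_cinv cc cu).
move=> x [cx Dx]; have xx := mem_chart_at x.
have E : cinv (chart_at x) (cmap (chart_at x) x) = x by rewrite cmapK.
have cs := plot_chart cc (plot_cinv (chart_at_compatible x) (cimg_cmap xx)).
rewrite E in cs; have ThS : smooth_at Th
  (cmap c (cinv (chart_at x) (cmap (chart_at x) x))).
  by rewrite E; exact: Th_smooth.
exact: smooth_at_comp (cs cx) ThS.
Qed.

End Compose.

Lemma restrict_chart m (M : manifold R m) (c : chart R M m) (U : set M) :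
  compatible_chart c -> open U -> exists c' : chart R M m, [/\ compatible_chart c',
  forall x, cdom c' x <-> cdom c x /\ U x & forall x, cmap c' x = cmap c x].
Proof.
move=> cc oU; pose D := [set u | cimg c u /\ U (cinv c u)].
have oD : open D.
  rewrite openE => u [cu Uu]; have n1 := near_cimg cu.
  have n2 : \forall v \near u, U (cinv c v).
    by apply: (near_comp (cinv_continuous cu)); exact: open_nbhs_nbhs.
  by apply: filterS2 n1 n2 => v; split.
have ids : smooth_on D id by move=> k; exact: Ck_id.
have [c' [cc' c'D c'E]] := @compose_chart _ _ _ D D id id cc oD oD
  (fun _ => id) (fun _ => id) (fun _ _ => erefl) (fun _ _ => erefl) ids ids.
exists c'; split=> // x; split=> [/c'D[cx [_]]|[cx Ux]].
  by rewrite cmapK.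
by apply/c'D; split=> //; split; [exact: cimg_cmap|rewrite cmapK].
Qed.

Section Transport.
Context {m : nat} (M N : manifold R m) (c : chart R M m).
Variables (f : M -> N) (g : N -> M).
Hypotheses (cc : compatible_chart c) (fs : smooth_map f) (gs : smooth_map g).
Hypotheses (fK : forall x, g (f x) = x) (gK : forall y, f (g y) = y).

Let dom : set N := g @^-1` cdom c.

Let imgE : (cmap c \o g) @` dom = cimg c.
Proof.
apply/seteqP; split=> [_ [y cy <-]|_ [x cx <-]] /=; first exact: cimg_cmap.
by exists (f x); rewrite /= ?fK // /dom /preimage /= fK.
Qed.

Let dom_open : open dom.
Proof.
apply: open_comp; last exact: cdom_open.
by move=> y _; exact: smooth_map_continuous openT gs _.
Qed.

Let img_open : open ((cmap c \o g) @` dom).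
Proof. by rewrite imgE; exact: cimg_open. Qed.

Let map_continuous y : dom y -> {for y, continuous (cmap c \o g)}.
Proof.
move=> cy; apply: continuous_comp; last exact: cmap_continuous.
exact: smooth_map_continuous openT gs _.
Qed.

Let inv_continuous u : ((cmap c \o g) @` dom) u ->
  {for u, continuous (f \o cinv c)}.
Proof.
rewrite imgE => cu; apply: continuous_comp; first exact: cinv_continuous.
exact: smooth_map_continuous openT fs _.
Qed.

Let mapK y : dom y -> (f \o cinv c) ((cmap c \o g) y) = y.
Proof. by move=> cy; rewrite /= cmapK. Qed.

Lemma transport_chart : exists c' : chart R N m, [/\ compatible_chart c',
  forall y, cdom c' y <-> cdom c (g y) & forall y, cmap c' y = cmap c (g y)].
Proof.
pose c' := Chart dom_open img_open map_continuous inv_continuous mapK.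
exists c'; split=> //; apply: compatible_plot.
  have cE : cimg c' = cimg c := imgE.
  move=> u; rewrite cE => cu.
  exact: smooth_map_plot fs (plot_cinv cc cu).
move=> y cy; have yy := mem_chart_at y.
have ip := plot_cinv (chart_at_compatible y) (cimg_cmap yy).
apply: (plot_chart cc (smooth_map_plot gs ip)).
by rewrite /= cmapK.
Qed.

End Transport.

Lemma prod_chart_compatible m k (M : manifold R m) (N : manifold R k)
    (c : chart R M m) (c' : chart R N k) :
  compatible_chart c -> compatible_chart c' ->
  @compatible_chart _ _ (prod_manifold M N) (prod_chart c c').
Proof.
move=> cc cc'; apply: compatible_plot.
  move=> u; rewrite /cimg prod_cimgE => -[cu c'u].
  have ls := smooth_at_lsubmx (smooth_at_id u).
  have rs := smooth_at_rsubmx (smooth_at_id u).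
  exact: plot_pair (plot_comp ls (plot_cinv cc cu))
    (plot_comp rs (plot_cinv cc' c'u)).
move=> p [cp c'p]; have pp := mem_chart_at p.
have E : cinv (chart_at p) (cmap (chart_at p) p) = p by rewrite cmapK.
have ip := plot_cinv (chart_at_compatible p) (cimg_cmap pp).
apply: smooth_at_row_mx.
  by apply: (plot_chart cc (plot_fst ip)); rewrite E.
by apply: (plot_chart cc' (plot_snd ip)); rewrite E.
Qed.

End Charts.

(** * Submanifolds and immersions *)

Section Submanifolds.
Context {R : realType}.

(** According to its shape, [pid_mx p] is the inclusion of the first [p] coordinates or the
    projection onto them. *)
Lemma mul_pidK p m (w : 'rV[R]_p) : (p <= m)%N ->
  w *m pid_mx p *m (pid_mx p : 'M[R]_(m, p)) = w.
Proof.
by move=> pm; rewrite -mulmxA mul_pid_mx minnn (minn_idPr pm) pid_mx_1 mulmx1.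
Qed.

Lemma mul_pid_coord p m (w : 'rV[R]_p) (i : 'I_m) : (p <= i)%N ->
  (w *m pid_mx p) ord0 i = 0.
Proof.
move=> pi; rewrite mxE big1 // => j _; rewrite mxE.
by rewrite (_ : (j == i :> nat) = false) ?mulr0 // ltn_eqF // (leq_trans _ pi).
Qed.

Lemma pid_mul_coord p m (u : 'rV[R]_m) : (p <= m)%N ->
  (forall i : 'I_m, (p <= i)%N -> u ord0 i = 0) ->
  u *m (pid_mx p : 'M[R]_(m, p)) *m pid_mx p = u.
Proof.
move=> pm u0; rewrite -mulmxA mul_pid_mx !minnn; apply/rowP => i.
rewrite mxE (bigD1 i) //= big1 => [|j ji].
  rewrite mxE eqxx addr0 /=; case: ltnP => [_|/u0 ->]; first by rewrite mulr1.
  by rewrite mul0r.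
by rewrite mxE (negbTE (_ : j != i :> nat)) ?mulr0.
Qed.

Section Slice.
Context {m p : nat} (M : manifold R m) (Z : set M) (c : chart R M m) (z : M).
Hypotheses (pm : (p <= m)%N) (cc : compatible_chart c) (cz : cdom c z) (Zz : Z z).
Hypothesis cZ : forall y, cdom c y ->
  (Z y <-> forall i : 'I_m, (p <= i)%N -> cmap c y ord0 i = 0).

Let psi := cmap (chart_at z) \o cinv c.
Let q (w : 'rV[R]_p) (t : R) := cmap c z + t *: (w *m (pid_mx p : 'M[R]_(p, m))).

Let q_smooth w : smooth_at (q w) 0.
Proof. by apply: smooth_atD; [exact: smooth_at_cst|exact: smooth_at_scalel]. Qed.

Let q0 w : q w 0 = cmap c z.
Proof. by rewrite /q scale0r addr0. Qed.

Let q_near w : \forall t \near (0 : R), cimg c (q w t).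
Proof.
apply: (near_comp (smooth_at_continuous (q_smooth w))).
by rewrite q0; exact/near_cimg/cimg_cmap.
Qed.

Lemma slice_curve w : curve (cinv c \o q w) z ('d psi (cmap c z) (w *m pid_mx p)) /\
  \forall t \near 0, Z (cinv c (q w t)).
Proof.
have [_ dq] := derive_line (cmap c z) (w *m (pid_mx p : 'M[R]_(p, m))) (0 : R).
split; first by have := chart_curve cc cz (q_smooth w) (q0 w); rewrite dq.
apply: filterS (q_near w) => t qt.
apply/(cZ (cdom_cinv qt)) => i pi; rewrite (cinvK qt) mxE.
by rewrite ((cZ cz).1 Zz) // add0r mxE mul_pid_coord // mulr0.
Qed.

Lemma slice_tangent_inj (w : 'rV[R]_p) : 'd psi (cmap c z) (w *m pid_mx p) = 0
  -> w = 0.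
Proof.
move=> d0; have [cw _] := slice_curve w; rewrite d0 in cw.
have := curve_chart cc cz cw; rewrite linear0.
have -> : 'D_1 (fun t => cmap c ((cinv c \o q w) t)) 0 = 'D_1 (q w) 0.
  by apply: near_eq_derive; apply: filterS (q_near w) => t qt /=; rewrite cinvK.
rewrite (derive_line _ _ _).2 => w0.
by rewrite -(mul_pidK w pm) w0 mul0mx.
Qed.

Lemma slice_tangent v : tangent Z z v ->
  exists w : 'rV[R]_p, v = 'd psi (cmap c z) (w *m pid_mx p).
Proof.
move=> /tangentP[g [gz gZ]]; have [gp g0 _] := gz.
have cs : smooth_at (fun t => cmap c (g t)) 0.
  by apply: plot_chart => //; rewrite g0.
have nc : \forall t \near (0 : R), cdom c (g t).
  by apply: (near_comp gp.1); rewrite g0; exact: near_cdom.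
pose u := 'D_1 (fun t => cmap c (g t)) 0.
exists (u *m pid_mx p); rewrite pid_mul_coord //; last first.
  move=> i pi; rewrite /u -derive_coord; last exact: smooth_at_differentiable.
  rewrite -[RHS](derive_cst (0 : R) (0 : R) (1 : R)); apply: near_eq_derive.
  by apply: filterS2 nc gZ => t ct /(cZ ct); exact.
have c0 : cmap c (g 0) = cmap c z by rewrite g0.
have := chart_curve cc cz cs c0.
apply: curve_unique; apply: near_eq_curve gz.
by apply: filterS nc => t ct /=; rewrite cmapK.
Qed.

End Slice.

(** Defined by curves, [tangent Z z] is not visibly a linear subspace. A slice chart presents it as
    the row space of a matrix of rank [p], which gives linearity and dimension at once. *)
Lemma tangent_row p m (M : manifold R m) (Z : set M) z : submanifold p Z -> Z z ->
  exists A : 'M[R]_(p, m), row_free A /\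
    forall v, tangent Z z v <-> exists w, v = w *m A.
Proof.
move=> sZ Zz; have [c [pm cc cz cZ]] := sZ z Zz.
pose psi := cmap (chart_at z) \o cinv c.
pose A : 'M[R]_(p, m) := pid_mx p *m 'J psi (cmap c z).
have AE w : w *m A = 'd psi (cmap c z) (w *m pid_mx p).
  by rewrite -mul_jacobian mulmxA.
exists A; split.
  by apply: inj_row_free => w; rewrite AE;
    exact: (slice_tangent_inj pm cc cz Zz cZ).
move=> v; split=> [/(slice_tangent pm cc cz cZ)[w ->]|[w ->]].
  by exists w; rewrite AE.
have [cw cwZ] := slice_curve cc cz Zz cZ w.
by rewrite AE; exact: tangent_curve cw cwZ.
Qed.

Lemma tangent_subset m (M : manifold R m) (Z Z' : set M) z v :
  Z `<=` Z' -> tangent Z z v -> tangent Z' z v.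
Proof.
move=> ZZ /tangentP[c [cz cZ]]; apply: (tangent_curve cz).
by apply: filterS cZ => t /ZZ.
Qed.

Lemma tangent_open m (M : manifold R m) (Z U : set M) z v : open U -> U z ->
  tangent Z z v -> tangent (Z `&` U) z v.
Proof.
move=> oU Uz /tangentP[c [cz cZ]]; have [cp c0 _] := cz.
apply: (tangent_curve cz).
have nU : \forall t \near (0 : R), U (c t).
  by apply: (near_comp cp.1); rewrite c0; exact: open_nbhs_nbhs.
by apply: filterS2 cZ nU => t; split.
Qed.

(** The two row spaces are nested and have the same rank. Thus a patch, being of full dimension, has
    the tangent spaces of the whole, and immersivity passes from patches to [L]. *)
Lemma tangent_sub_eq p m (M : manifold R m) (Z Z' : set M) z v :
  submanifold p Z -> submanifold p Z' -> Z `<=` Z' -> Z z ->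
  tangent Z' z v -> tangent Z z v.
Proof.
move=> sZ sZ' ZZ Zz; have [A [Af AE]] := tangent_row sZ Zz.
have [B [Bf BE]] := tangent_row sZ' (ZZ _ Zz).
have AB : (A <= B)%MS.
  apply/row_subP => i; apply/submxP; apply/BE.
  by apply: (tangent_subset ZZ); apply/AE; exists (delta_mx 0 i); rewrite rowE.
have BA : (B <= A)%MS
  by rewrite -(geq_leqif (mxrank_leqif_sup AB)) (eqP Af) (eqP Bf).
move=> /BE[w ->]; apply/AE; apply/submxP.
exact: submx_trans (submxMl _ _) BA.
Qed.

Lemma submanifold_open p m (M : manifold R m) (Z U : set M) : open U ->
  submanifold p Z -> submanifold p (Z `&` U).
Proof.
move=> oU sZ z [Zz Uz]; have [c [pm cc cz cZ]] := sZ z Zz.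
have [c' [cc' c'D c'E]] := restrict_chart cc oU.
exists c'; split=> //; first exact/c'D.
by move=> y /c'D[cy Uy]; rewrite c'E -cZ //; split=> [[]|].
Qed.

Lemma open_submanifold m (M : manifold R m) (U : set M) : open U -> submanifold m U.
Proof.
move=> oU x Ux.
have [c' [cc' c'D _]] := restrict_chart (chart_at_compatible x) oU.
exists c'; split=> //.
  by apply/c'D; split=> //; exact: mem_chart_at.
by move=> y /c'D[_ Uy]; split=> // _ i; rewrite leqNgt ltn_ord.
Qed.

Lemma image_submanifold p m (M N : manifold R m) (f : M -> N) (g : N -> M)
    (Z : set M) : smooth_map f -> smooth_map g ->
  (forall x, g (f x) = x) -> (forall y, f (g y) = y) ->
  submanifold p Z -> submanifold p (f @` Z).
Proof.
move=> fs gs fK gK sZ _ [z Zz <-]; have [c [pm cc cz cZ]] := sZ z Zz.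
have [c' [cc' c'D c'E]] := transport_chart cc fs gs fK gK.
exists c'; split=> //; first by apply/c'D; rewrite fK.
move=> y /c'D cy; rewrite c'E -cZ //; split=> [[x Zx <-]|Zgy]; first by rewrite fK.
by exists (g y).
Qed.

End Submanifolds.

(** * Immersions between equal dimensions and their local inverses *)

Section Immersions.
Context {R : realType}.

Definition immersed_at m k (M : manifold R m) (N : manifold R k) (f : M -> N)
    (Z : set M) z := forall v, tangent Z z v -> mdiff f z v = 0 -> v = 0.

(** Read in slice coordinates of [Z] and in a chart of [N], the map [f] goes between open sets of
    the same space 'rV_d with injective differential, so the inverse function theorem applies. *)
Lemma immersion_inverse m d (M : manifold R m) (N : manifold R d) (f : M -> N)
    (Z : set M) z :
  smooth_map f -> submanifold d Z -> Z z -> immersed_at f Z z ->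
  exists (U : set M) (Y : set N) (g : N -> M), [/\ open U, U z & open Y] /\
    [/\ forall x, Z x -> U x -> Y (f x) /\ g (f x) = x,
        forall y, Y y -> [/\ Z (g y), U (g y) & f (g y) = y] &
        smooth_map_on Y g].
Proof.
move=> fs sZ Zz fi; have [c [pm cc cz cZ]] := sZ z Zz.
pose E : 'M[R]_(d, m) := pid_mx d; pose E' : 'M[R]_(m, d) := pid_mx d.
have ZE x : cdom c x -> Z x -> cmap c x *m E' *m E = cmap c x.
  by move=> cx Zx; rewrite pid_mul_coord //; exact/cZ.
pose u0 := cmap c z *m E'; have u0E : u0 *m E = cmap c z by exact: ZE.
pose cy := chart_at (f z); have cyz : cdom cy (f z) := mem_chart_at _.
have P1 u : cimg c (u *m E) -> plot (fun u => cinv c (u *m E)) u.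
  by move=> cu; apply: (plot_comp (smooth_at_mulmx E (smooth_at_id u)));
    exact: plot_cinv.
pose F u := cmap cy (f (cinv c (u *m E))).
have cu0 : cimg c (u0 *m E) by rewrite u0E; exact: cimg_cmap.
have iu0 : cinv c (u0 *m E) = z by rewrite u0E cmapK.
have fp := smooth_map_plot fs (P1 _ cu0).
have Fs : smooth_at F u0 by have := fp.2; rewrite /= iu0.
have Finj w : 'd F u0 w = 0 -> w = 0.
  move=> dF0; have [cw cwZ] := slice_curve cc cz Zz cZ w.
  have tw := tangent_curve cw cwZ.
  apply: (slice_tangent_inj pm cc cz Zz cZ); apply: fi => //.
  have [_ _ <-] := curve_map fs cw.
  have [dl dlE] := derive_line u0 w (0 : R).
  have FE : (fun t => cmap (chart_at (f z)) ((f \o (cinv c \o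
      (fun t : R => cmap c z + t *: (w *m pid_mx d)))) t)) = F \o
        (fun t : R => u0 + t *: w).
    by apply/funext => t; rewrite /F /= mulmxDl u0E -scalemxAl.
  rewrite FE derive_diff_comp //; last first.
    by rewrite scale0r addr0; exact: smooth_at_differentiable.
  by rewrite dlE scale0r addr0.
pose N0 : set 'rV[R]_d :=
  [set u | cimg c (u *m E) /\ cdom cy (f (cinv c (u *m E)))].
have nN0 : nbhs u0 N0.
  have n1 : \forall u \near u0, cimg c (u *m E).
    apply: (near_comp (smooth_at_continuous (smooth_at_mulmx E (smooth_at_id u0)))).
    exact: near_cimg.
  have n2 : \forall u \near u0, cdom cy (f (cinv c (u *m E))).
    by apply: (near_comp fp.1); rewrite /= iu0; exact: near_cdom.
  exact: filterI n1 n2.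
have [V [W [G [[oV Vu0 VN oW] [VW WV Vs Ws]]]]] := inverse_function nN0 Fs Finj.
pose U := [set x | cdom c x /\ V (cmap c x *m E')].
pose Y := [set y | cdom cy y /\ W (cmap cy y)].
pose g y := cinv c (G (cmap cy y) *m E).
exists U, Y, g; split; split.
- rewrite openE => x [cx Vx]; have n1 := near_cdom cx.
  have n2 : \forall x' \near x, V (cmap c x' *m E').
    have hc : {for x, continuous ((fun u => u *m E') \o cmap c)}.
      apply: continuous_comp; first exact: cmap_continuous.
      exact: (smooth_at_continuous (smooth_at_mulmx E' (smooth_at_id (cmap c x)))).
    by apply: (near_comp hc); exact: open_nbhs_nbhs.
  by apply: filterS2 n1 n2 => x'; split.
- by [].
- rewrite openE => y [yy Wy]; have n1 := near_cdom yy.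
  have n2 : \forall y' \near y, W (cmap cy y').
    by apply: (near_comp (cmap_continuous yy)); exact: open_nbhs_nbhs.
  by apply: filterS2 n1 n2 => y'; split.
- move=> x Zx [cx Vx]; have [_ fx] := VN _ Vx; have [Wx GF] := VW _ Vx.
  rewrite ZE ?cmapK // in fx; rewrite /F ZE ?cmapK // in Wx GF.
  by split=> //; rewrite /g GF ZE ?cmapK.
- move=> y [yy Wy]; have [Vg Fg] := WV _ Wy; have [cg fg] := VN _ Vg.
  have cE : cmap c (g y) = G (cmap cy y) *m E by rewrite /g cinvK.
  have dg : cdom c (g y) by rewrite /g; exact: cdom_cinv.
  split.
  + by apply/(cZ _ dg) => i di; rewrite cE mul_pid_coord.
  + by split=> //; rewrite cE mul_pidK.
  by rewrite -[RHS](cmapK yy) -Fg /F (cmapK fg).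
apply: plot_smooth_map_on => y [yy Wy].
have ip := plot_cinv (chart_at_compatible y) (cimg_cmap (mem_chart_at y)).
have iE : cinv (chart_at y) (cmap (chart_at y) y) = y by rewrite cmapK //;
  exact: mem_chart_at.
have ys := plot_chart (chart_at_compatible (f z)) ip; rewrite iE in ys.
have {}ys := ys yy.
have Gs : smooth_at G (cmap cy (cinv (chart_at y) (cmap (chart_at y) y))).
  by rewrite iE; exact: smooth_on_at Ws _.
have [cg _] := VN _ (WV _ Wy).1.
apply: (plot_comp (p := fun u => cinv c (u *m E)) (smooth_at_comp ys Gs)).
by rewrite /= iE; exact: P1.
Qed.

(** The local inverses show that the range is open, hence a submanifold. Any map inverting [f] on
    [Z] coincides with them where they are defined, and so is smooth. *)
Lemma immersion_diffeo m d (M : manifold R m) (N : manifold R d) (f : M -> N)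
    (Z : set M) : smooth_map f -> submanifold d Z ->
  (forall z, Z z -> immersed_at f Z z) ->
  (forall y z, Z y -> Z z -> f y = f z -> y = z) ->
  open (f @` Z) /\ diffeo_onto_range f Z.
Proof.
move=> fs sZ fi f_inj.
have loc z : Z z -> exists Y (g : N -> M), [/\ open Y, Y (f z), smooth_map_on Y g &
    forall y, Y y -> Z (g y) /\ f (g y) = y].
  move=> Zz; have [U [Y [g [[oU Uz oO] [ZU Og gs]]]]] :=
    immersion_inverse fs sZ Zz (fi z Zz).
  exists Y, g; split=> //; first by have [] := ZU z Zz Uz.
  by move=> y /Og[].
have ofZ : open (f @` Z).
  rewrite openE => _ [z Zz <-]; have [Y [g [oO Oz gs Og]]] := loc z Zz.
  have nO : \forall y \near f z, Y y by exact: open_nbhs_nbhs.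
  by apply: filterS nO => y /Og[Zg <-]; exists (g y).
split=> //; split=> //.
- apply: plot_smooth_map_on => x _; apply: smooth_map_plot => //.
  by apply: plot_cinv; [exact: chart_at_compatible|exact/cimg_cmap/mem_chart_at].
- by exists d; exact: open_submanifold.
move=> h hK; apply: plot_smooth_map_on => _ [z Zz <-].
have [Y [g [oO Oz gs Og]]] := loc z Zz.
have zz := mem_chart_at (f z);
  have E : cinv (chart_at (f z)) (cmap (chart_at (f z)) (f z)) = f z.
  by rewrite cmapK.
have ip := plot_cinv (chart_at_compatible (f z)) (cimg_cmap zz).
have nO : \forall u \near cmap (chart_at (f z)) (f z), Y (cinv (chart_at (f z)) u).
  by apply: (near_comp ip.1); rewrite E; exact: open_nbhs_nbhs.
apply: near_eq_plot (plot_map gs nO ip).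
apply: filterS nO => u Ou /=; have [Zg fg] := Og _ Ou.
by rewrite -[in RHS]fg hK.
Qed.

Lemma immersed_subset m k (M : manifold R m) (N : manifold R k) (f : M -> N)
    (Z Z' : set M) z : Z `<=` Z' -> immersed_at f Z' z -> immersed_at f Z z.
Proof. by move=> ZZ fi v /(tangent_subset ZZ); exact: fi. Qed.

Lemma immersion_local_diffeo m d (M : manifold R m) (N : manifold R d) (f : M -> N)
    (Z : set M) : smooth_map f -> submanifold d Z ->
  (forall z, Z z -> immersed_at f Z z) -> local_diffeo f Z.
Proof.
move=> fs sZ fi z Zz.
have [U [Y [g [[oU Uz oO] [ZU Og gs]]]]] := immersion_inverse fs sZ Zz (fi z Zz).
have [||oZU dZU] := @immersion_diffeo _ _ _ _ f (Z `&` U) fs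
  (submanifold_open oU sZ).
- by move=> x [Zx _]; apply: immersed_subset (fi x Zx) => y [].
- move=> x y [Zx Ux] [Zy Uy] fxy.
  by rewrite -(ZU _ Zx Ux).2 fxy (ZU _ Zy Uy).2.
by exists U.
Qed.

(** A curve in [Z] is recovered from its image by the smooth inverse, so if the image has zero
    velocity, so has the curve. *)
Lemma diffeo_immersed m k (M : manifold R m) (N : manifold R k) (f : M -> N)
    (Z : set M) z : smooth_map f -> diffeo_onto_range f Z -> Z z ->
      immersed_at f Z z.
Proof.
move=> fs [_ f_inj _ gs] Zz v /tangentP[c [cz cZ]] dv0.
(* [diffeo_onto_range] speaks of every left inverse of [f] on [Z], so one must be produced; off the
   range it takes the default value [z]. *)
pose g y := xget z [set x | Z x /\ f x = y].
have gK x : Z x -> g (f x) = x.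
  move=> Zx; have [Zg fg] : [set x' | Z x' /\ f x' = f x] (g (f x)).
    by apply: xgetPex; exists x.
  exact: f_inj.
have [cp c0 cv] := cz.
have [U [h [oU Uz hs hE]]] := gs g gK (f z) (ex_intro2 _ _ z Zz erefl).
rewrite gK // in hE.
have fcz := curve_map fs cz; rewrite dv0 in fcz; have [fcp fc0 fcv] := fcz.
have ys := curve_smooth fcz.
have hsm : smooth_at h (cmap (chart_at (f z)) ((f \o c) 0)).
  by rewrite fc0; exact: smooth_on_at hs _.
have n1 : \forall t \near (0 : R), cdom (chart_at (f z)) (f (c t)).
  by apply: (near_comp fcp.1); rewrite fc0; exact/near_cdom/mem_chart_at.
have n2 : \forall t \near (0 : R), U (cmap (chart_at (f z)) (f (c t))).
  by apply: (near_comp (smooth_at_continuous ys)); rewrite fc0;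
    exact: open_nbhs_nbhs.
rewrite -cv.
have -> : 'D_1 (fun t => cmap (chart_at z) (c t)) 0 =
    'D_1 (h \o (fun t => cmap (chart_at (f z)) ((f \o c) t))) 0.
  apply: near_eq_derive; apply: filterS3 cZ n1 n2 => t Zt ct Ut.
  by have [_ /= <-] := hE (f (c t)) (ex_intro2 _ _ (c t) Zt erefl) ct Ut;
    rewrite gK.
rewrite derive_diff_comp ?fcv ?linear0 //; exact: smooth_at_differentiable.
Qed.

Lemma local_diffeo_immersed m k (M : manifold R m) (N : manifold R k) (f : M -> N)
    (Z : set M) z : smooth_map f -> local_diffeo f Z -> Z z -> immersed_at f Z z.
Proof.
move=> fs fl Zz v tv; have [U [oU Uz _ dU]] := fl z Zz.
exact: (diffeo_immersed fs dU (conj Zz Uz)) (tangent_open oU Uz tv).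
Qed.

Lemma immersed_dim p m k (M : manifold R m) (N : manifold R k) (f : M -> N)
    (Z : set M) z : submanifold p Z -> Z z -> immersed_at f Z z -> (p <= k)%N.
Proof.
move=> sZ Zz fi; have [A [Af AE]] := tangent_row sZ Zz.
pose B := lin1_mx (mdiff f z).
have : row_free (A *m B).
  apply: inj_row_free => w; rewrite mulmxA mul_rV_lin1 => w0.
  apply: (row_free_inj Af); rewrite mul0mx; apply: fi => //.
  by apply/AE; exists w.
by rewrite /row_free => /eqP <-; exact: rank_leq_col.
Qed.

(** Equality of dimensions turns injectivity of the differential into surjectivity, the source of
    transversality. *)
Lemma immersed_onto d m (M : manifold R m) (N : manifold R d) (f : M -> N)
    (Z : set M) z w : submanifold d Z -> Z z -> immersed_at f Z z ->
  exists2 v, tangent Z z v & mdiff f z v = w.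
Proof.
move=> sZ Zz fi; have [A [Af AE]] := tangent_row sZ Zz.
pose B := lin1_mx (mdiff f z).
have AB : A *m B \in unitmx.
  apply: injective_unitmx => u; rewrite mulmxA mul_rV_lin1 => u0.
  apply: (row_free_inj Af); rewrite mul0mx; apply: fi => //.
  by apply/AE; exists u.
exists (w *m invmx (A *m B) *m A); first by apply/AE; eexists.
by rewrite -[mdiff f z _]mul_rV_lin1 -/B -(mulmxA _ A B) mulmxKV.
Qed.

End Immersions.

Section MdiffLinear.
Context {R : realType} {m k : nat} {M : manifold R m} {N : manifold R k}.

Lemma mdiff0 (f : M -> N) x : mdiff f x 0 = 0.
Proof. exact: linear0. Qed.

Lemma mdiffB (f : M -> N) x v w : mdiff f x (v - w) = mdiff f x v - mdiff f x w.
Proof. exact: linearB. Qed.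

Lemma immersed_inj p (f : M -> N) (Z : set M) z v w : submanifold p Z -> Z z ->
  immersed_at f Z z -> tangent Z z v -> tangent Z z w ->
  mdiff f z v = mdiff f z w -> v = w.
Proof.
move=> sZ Zz fi tv tw vw; have [A [_ AE]] := tangent_row sZ Zz.
apply/eqP; rewrite -subr_eq0; apply/eqP; apply: fi; last by rewrite mdiffB vw subrr.
have [a ->] := (AE v).1 tv; have [b ->] := (AE w).1 tw.
by apply/AE; exists (a - b); rewrite mulmxBl.
Qed.

End MdiffLinear.

(** * Symplectic groupoids *)

Section Algebra.
Context {R : realType} {m d : nat} (G : lie_groupoid R m d).
Implicit Types g h : G.

Lemma ginvK g : ginv (ginv g) = g.
Proof.
have h1 : gsrc (ginv (ginv g)) = grng (ginv g) by rewrite gsrc_inv.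
have := gmulA h1 (gsrc_inv g).
by rewrite !gmulVg gsrc_inv gmul1g -[gsrc g]grng_inv -gsrc_inv gmulg1.
Qed.

(** Meant for products known to lie in [range_set] or [source_set], that is, to be some unit: which
    unit is forced by the range of [g]. *)
Lemma gmul_unit_inv g h x : gsrc g = grng h -> gmul g h = gunit x -> h = ginv g.
Proof.
move=> gh ghx; have xE : x = grng g by rewrite -(grng_mul gh) ghx grng_unit.
have := gmulA (gsrc_inv g) gh.
by rewrite gmulVg gh gmul1g ghx xE -gsrc_inv gmulg1.
Qed.

Lemma gmul_unit_unit x : gmul (gunit x) (gunit x) = gunit x :> G.
Proof. by have := gmul1g (gunit x : G); rewrite grng_unit. Qed.

Lemma starK (L : set G) : (@ginv _ _ _ G) @` (@ginv _ _ _ G @` L) = L.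
Proof.
apply/seteqP; split=> [_ [_ [g Lg <-] <-]|g Lg]; first by rewrite ginvK.
by exists (ginv g); [exists g|rewrite ginvK].
Qed.

End Algebra.

Section LinearForms.
Context {R : realType}.

Lemma bilin_block m1 m2 (A : 'M[R]_m1) (B : 'M[R]_m2) v w v' w' :
  bilin (block_mx A 0 0 B) (row_mx v w) (row_mx v' w') = bilin A v v' + bilin B
    w w'.
Proof.
by rewrite /bilin mul_row_block !mulmx0 addr0 add0r tr_row_mx mul_row_col mxE.
Qed.

Lemma bilinN m (A : 'M[R]_m) v w : bilin (- A) v w = - bilin A v w.
Proof. by rewrite /bilin mulmxN mulNmx mxE. Qed.

(** [U *m A] and [U] both have rank [d], and [U *m A *m U^T] vanishes, so [d + d <= m]. *)
Lemma isotropic_rank d m (A : 'M[R]_m) (U : 'M[R]_(d, m)) : A \in unitmx ->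
  row_free U -> (forall a b : 'rV_d, bilin A (a *m U) (b *m U) = 0) ->
    (d <= m./2)%N.
Proof.
move=> Au Uf AU.
have UAU : (U *m A) *m U^T = 0.
  apply/matrixP => i j; rewrite [RHS]mxE -(AU (delta_mx 0 i) (delta_mx 0 j)) /bilin.
  rewrite trmx_mul trmx_delta !mulmxA -colE [RHS]mxE -!mulmxA -rowE.
  by rewrite [RHS]mxE.
have := mulmx0_rank_max UAU.
rewrite mxrank_tr mxrankMfree ?row_free_unit // (eqP Uf) => dm.
by rewrite geq_half_double -addnn.
Qed.

End LinearForms.

(** * The symplectic form on units and under inversion *)

Section Symplectic.
Context {R : realType} {m d : nat} (G : symplectic_groupoid R m d).
Local Notation om := (@sform R m d G).

(** Multiplicativity of the form: along the multiplication graph, the form at a product is the sum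
    of the forms at its factors. *)
Lemma graph_isotropic (g h : G) (v w u v' w' u' : 'rV[R]_m) :
  let T := tangent (@gmul_graph R m d G) ((g, h), gmul g h) in
  gsrc g = grng h -> T (row_mx (row_mx v w) u) -> T (row_mx (row_mx v' w') u') ->
  bilin (om g) v v' + bilin (om h) w w' - bilin (om (gmul g h)) u u' = 0.
Proof.
move=> T gh Tv Tv'; have [_ iso] := gmul_graph_lagrangian G.
have := iso ((g, h), gmul g h) (conj gh erefl) _ _ Tv Tv'.
by rewrite /prod_form /= !bilin_block bilinN.
Qed.

Lemma graph_tangent (a b : R -> G) (g h : G) v w u :
  curve a g v -> curve b h w -> curve (fun t => gmul (a t) (b t)) (gmul g h) u ->
  (\forall t \near 0, gsrc (a t) = grng (b t)) ->
  tangent (@gmul_graph R m d G) ((g, h), gmul g h) (row_mx (row_mx v w) u).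
Proof.
move=> ag bh abc nab; apply: (tangent_curve (curve_pair (curve_pair ag bh) abc)).
by apply: filterS nab => t.
Qed.

(** A curve of units [x] gives a curve (x, x, x) in the graph, so the form satisfies
    [om + om - om = 0] on such velocities. *)
Lemma unit_isotropic (x : objects G) a b :
  bilin (om (gunit x)) (mdiff (@gunit _ _ _ G) x a) (mdiff (@gunit _ _ _ G) x b)
    = 0.
Proof.
pose du := mdiff (@gunit _ _ _ G) x.
have T e : tangent (@gmul_graph R m d G)
    ((gunit x, gunit x), gmul (gunit x) (gunit x))
      (row_mx (row_mx (du e) (du e)) (du e)).
  have [c cx] := curve_exists x e; have uc := curve_map (@gunit_smooth _ _ _ G) cx.
  apply: (graph_tangent uc uc).
    rewrite gmul_unit_unit; apply: near_eq_curve uc.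
    by near=> t; rewrite /= gmul_unit_unit.
  by near=> t; rewrite gsrc_unit grng_unit.
have ux : gsrc (gunit x : G) = grng (gunit x : G) by rewrite gsrc_unit grng_unit.
have := graph_isotropic ux (T a) (T b).
by rewrite gmul_unit_unit addrK.
Unshelve. all: by end_near. Qed.

(** The unit map has the left inverse [grng], so its differential is injective and its image is an
    isotropic space of dimension [d]. *)
Lemma objects_dim_le (x : objects G) : (d <= m./2)%N.
Proof.
have [_ omu _ _] := sform_symplectic G.
pose U := lin1_mx (mdiff (@gunit _ _ _ G) x).
apply: (isotropic_rank (U := U) (omu (gunit x))).
  apply: inj_row_free => a; rewrite mul_rV_lin1 => a0.
  have {}a0 : mdiff (@gunit _ _ _ G) x a = 0 := a0.
  have := mdiff_id_comp x a (@gunit_smooth _ _ _ G) (@grng_submersion _ _ _ G).1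
    (@grng_unit _ _ _ G).
  by rewrite a0 mdiff0.
by move=> a b; rewrite !mul_rV_lin1; exact: unit_isotropic.
Qed.

(** The triples (g, g^-1, unit) lie in the graph and the form vanishes on the third component, so
    the contributions of [g] and of its inverse cancel. *)
Lemma ginv_antisymplectic (g : G) v w :
  bilin (om (ginv g)) (mdiff (@ginv _ _ _ G) g v) (mdiff (@ginv _ _ _ G) g w) =
  - bilin (om g) v w.
Proof.
pose di := mdiff (@ginv _ _ _ G) g; pose dr := mdiff (@grng _ _ _ G) g.
pose du := mdiff (@gunit _ _ _ G) (grng g).
have T e : tangent (@gmul_graph R m d G)
    ((g, ginv g), gmul g (ginv g)) (row_mx (row_mx e (di e)) (du (dr e))).
  have [c cg] := curve_exists g e; have ic := curve_map (@ginv_smooth _ _ _ G) cg.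
  have uc := curve_map (@gunit_smooth _ _ _ G)
    (curve_map (@grng_submersion _ _ _ G).1 cg).
  apply: (graph_tangent cg ic).
    rewrite gmulgV; apply: near_eq_curve uc.
    by near=> t; rewrite /= gmulgV.
  by near=> t; rewrite /= grng_inv.
have gi : gsrc g = grng (ginv g) by rewrite grng_inv.
have := graph_isotropic gi (T v) (T w).
rewrite gmulgV unit_isotropic subr0 => /eqP.
by rewrite addrC addr_eq0 => /eqP.
Unshelve. all: by end_near. Qed.

Lemma star_lagrangian (L : set G) : lagrangian om L -> lagrangian om (star L).
Proof.
move=> [sL iL]; split.
  apply: (image_submanifold (@ginv_smooth _ _ _ G) (@ginv_smooth _ _ _ G)) =>
    //; exact: ginvK.
move=> z sz v w tv tw.
have back x : star L x -> L (ginv x) by move=> [g Lg <-]; rewrite ginvK.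
have tm := tangent_map (@ginv_smooth _ _ _ G) back.
have := iL _ (back _ sz) _ _ (tm _ _ tv) (tm _ _ tw).
by rewrite ginv_antisymplectic => /eqP; rewrite oppr_eq0 => /eqP.
Qed.

End Symplectic.

Section SliceProduct.
Context {R : realType}.

Lemma row_mx_slice p m k (a : 'rV[R]_m) (b : 'rV[R]_k) : (p <= m)%N ->
  (forall i : 'I_(m + k), (p <= i)%N -> (row_mx a b) ord0 i = 0) <->
  (forall i : 'I_m, (p <= i)%N -> a ord0 i = 0) /\ b = 0.
Proof.
move=> pm; split=> [ab|[a0 ->] i pi].
  split=> [i pi|]; first by rewrite -(row_mxEl a b) ab.
  apply/rowP => j; rewrite -(row_mxEr a b) ab ?mxE //=.
  exact: leq_trans pm (leq_addr _ _).
rewrite mxE; case: splitP => j ij; last by rewrite mxE.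
by apply: a0; rewrite -ij.
Qed.

(** The graph of [f] over a slice of [Z] is itself a slice of the product, of the same dimension. It
    supplies the charts that exhibit the composable pairs of [L] and [star L] as a submanifold. *)
Lemma graph_slice m k p (M : manifold R m) (N : manifold R k) (Z : set M)
    (c : chart R M m) (c' : chart R N k) (f : M -> N) x0 :
  (p <= m)%N -> compatible_chart c -> compatible_chart c' ->
  (forall y, cdom c y ->
    (Z y <-> forall i : 'I_m, (p <= i)%N -> cmap c y ord0 i = 0)) ->
  cdom c x0 -> cdom c' (f x0) -> plot (f \o cinv c) (cmap c x0) ->
  exists e : chart R (prod_manifold M N) (m + k), [/\ compatible_chart e,
    cdom e (x0, f x0),
    forall q, cdom e q -> [/\ cdom c q.1, cdom c' q.2 & cdom c' (f q.1)] &
    forall q, cdom e q -> ((Z q.1 /\ q.2 = f q.1) <->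
      forall i : 'I_(m + k), (p <= i)%N -> cmap e q ord0 i = 0)].
Proof.
move=> pm cc cc' cZ cx cf fp.
have E : cinv c (cmap c x0) = x0 by rewrite cmapK.
pose F u := cmap c' (f (cinv c u)).
have Fs : smooth_at F (cmap c x0) by apply: (plot_chart cc' fp); rewrite /= E.
have nc' : \forall u \near cmap c x0, cdom c' (f (cinv c u)).
  by apply: (near_comp fp.1); rewrite /= E; exact: near_cdom.
have [A [oA Ax AP]] := near_open (filterI (near_smooth_at Fs) nc').
pose D : set 'rV[R]_(m + k) := [set w | A (lsubmx w)].
have oD : open D by apply: open_comp => // w _; exact: continuous_lsubmx.
(* In the product chart the graph is w.2 = F w.1; a shear makes it w.2 = 0. *)
pose Th (w : 'rV[R]_(m + k)) := row_mx (lsubmx w) (rsubmx w - F (lsubmx w)).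
pose Th' (w : 'rV[R]_(m + k)) := row_mx (lsubmx w) (rsubmx w + F (lsubmx w)).
have FD w : D w -> smooth_at (fun w : 'rV[R]_(m + k) => F (lsubmx w)) w.
  move=> /AP[Fw _].
  exact: (smooth_at_comp (smooth_at_lsubmx (smooth_at_id w)) Fw).
have ThD w : D w -> D (Th w) by rewrite /D /Th /= row_mxKl.
have ThD' w : D w -> D (Th' w) by rewrite /D /Th' /= row_mxKl.
have ThK w : D w -> Th' (Th w) = w.
  by move=> _; rewrite /Th /Th' row_mxKl row_mxKr subrK hsubmxK.
have ThK' w : D w -> Th (Th' w) = w.
  by move=> _; rewrite /Th /Th' row_mxKl row_mxKr addrK hsubmxK.
have Ths : smooth_on D Th.
  apply: smooth_at_on => w Dw; apply: smooth_at_row_mx.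
    exact: smooth_at_lsubmx (smooth_at_id w).
  by apply: smooth_atB; [exact: smooth_at_rsubmx (smooth_at_id w)|exact: FD].
have Ths' : smooth_on D Th'.
  apply: smooth_at_on => w Dw; apply: smooth_at_row_mx.
    exact: smooth_at_lsubmx (smooth_at_id w).
  by apply: smooth_atD; [exact: smooth_at_rsubmx (smooth_at_id w)|exact: FD].
have [e [ce eD eE]] := compose_chart (prod_chart_compatible cc cc') oD oD
  ThD ThD' ThK ThK' Ths Ths'.
have eDP q : cdom e q -> [/\ cdom c q.1, cdom c' q.2 & cdom c' (f q.1)].
  move=> /eD[[cq c'q]]; rewrite /D /= row_mxKl => /AP[_].
  by rewrite cmapK.
exists e; split=> //.
  by apply/eD; split; [|rewrite /D /= row_mxKl].
move=> q qe; have [cq c'q c'f] := eDP q qe.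
rewrite eE /Th /= row_mxKl row_mxKr; split.
  move=> [Zq ->]; apply/row_mx_slice => //; split; first exact/cZ.
  by rewrite /F cmapK // subrr.
move=> /row_mx_slice[//|q0 /eqP]; rewrite subr_eq0 /F cmapK // => /eqP qf.
by split; [exact/cZ|rewrite -(cmapK c'q) qf cmapK].
Qed.

End SliceProduct.

(** * Consequences of invertibility, and transversality of [L] with [star L] *)

Section Inverses.
Context {R : realType} {m d : nat} (G : symplectic_groupoid R m d).
Implicit Types L : set G.
Local Notation om := (@sform R m d G).
Local Notation r := (@grng R m d G).
Local Notation s := (@gsrc R m d G).
Local Notation inv := (@ginv R m d G).
Local Notation rsm := (@grng_submersion R m d G).1.
Local Notation ssm := (@gsrc_submersion R m d G).1.
Local Notation ism := (@ginv_smooth R m d G).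

Lemma mdiff_rng_inv (g : G) v : mdiff r (inv g) (mdiff inv g v) = mdiff s g v.
Proof.
have [c cg] := curve_exists g v.
have := curve_map rsm (curve_map ism cg).
have -> : r \o (inv \o c) = s \o c by apply/funext => t /=; rewrite grng_inv.
rewrite grng_inv => rc; exact: curve_unique rc (curve_map ssm cg).
Qed.

Lemma mdiff_src_inv (g : G) v : mdiff s (inv g) (mdiff inv g v) = mdiff r g v.
Proof.
have [c cg] := curve_exists g v.
have := curve_map ssm (curve_map ism cg).
have -> : s \o (inv \o c) = r \o c by apply/funext => t /=; rewrite gsrc_inv.
rewrite gsrc_inv => sc; exact: curve_unique sc (curve_map rsm cg).
Qed.

Lemma mdiff_invK (g : G) v : mdiff inv (inv g) (mdiff inv g v) = v.
Proof. exact: mdiff_id_comp ism ism (@ginvK _ _ _ G). Qed.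

(* The inclusion can be strict: L' may have further arrows that are composable
   with no arrow of L. *)
Lemma inverse_star_subset L L' : is_inverse L L' -> star L `<=` L'.
Proof.
move=> [_ _ _ LL' L'L] _ [g Lg <-].
(* The unit at the source of [g] is a product [k h] in [L'.L], which provides an arrow [k] of [L']
   composable with [g]. Then [g k] lies in [L.L'], so it is a unit and [k] is the inverse of [g]. *)
have : source_set L (gunit (s g)) by exists g.
rewrite -L'L => -[[k h] [[/= L'k Lh] kh] /= khE].
have hk : h = inv k := gmul_unit_inv kh khE.
have sh : s h = s g by rewrite -(gsrc_mul kh) khE gsrc_unit.
have gk : s g = r k by rewrite -sh hk gsrc_inv.
have : convolution L L' (gmul g k) by exists (g, k).
rewrite LL' => -[l _ /esym gkE].
by rewrite -(gmul_unit_inv gk gkE).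
Qed.

Lemma inverse_src_inj L L' g h : is_inverse L L' -> L g -> L h -> s g = s h ->
  g = h.
Proof.
move=> inv' Lg Lh gh; have [_ _ _ LL' _] := inv'.
have L'h : L' (inv h) by apply: (inverse_star_subset inv'); exists h.
have ghc : s g = r (inv h) by rewrite grng_inv.
have : convolution L L' (gmul g (inv h)) by exists (g, inv h).
rewrite LL' => -[l _ /esym /(gmul_unit_inv ghc) ghE].
by rewrite -(ginvK g) -ghE ginvK.
Qed.

Lemma inverse_rng_inj L L' g h : is_inverse L L' -> L g -> L h -> r g = r h ->
  g = h.
Proof.
move=> inv' Lg Lh gh; have [_ _ _ _ L'L] := inv'.
have L'g : L' (inv g) by apply: (inverse_star_subset inv'); exists g.
have ghc : s (inv g) = r h by rewrite gsrc_inv.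
have : convolution L' L (gmul (inv g) h) by exists (inv g, h).
by rewrite L'L => -[l _ /esym /(gmul_unit_inv ghc) ->]; rewrite ginvK.
Qed.

Lemma inverse_src_immersed L L' g : is_inverse L L' -> L g -> immersed_at s L g.
Proof.
move=> inv' Lg v /tangentP[c [cg cL]] dv0.
have [_ [_ clean] _ LL' _] := inv'.
have L'g : L' (inv g) by apply: (inverse_star_subset inv'); exists g.
(* Since [v] is killed by the differential of [s], the curve [s \o c] has zero velocity and lifts
   through [r] to a curve at [inv g] of zero velocity. Paired with [c], it makes [(v, 0)] tangent to
   the composable pairs. *)
have sc := curve_map ssm cg; rewrite dv0 -(grng_inv g) in sc.
rewrite -(mdiff0 r (inv g)) in sc.
have [b [bg bE]] := lift_curve (@grng_submersion _ _ _ G) sc.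
have Tc : tangent (@composable R m d G) (g, inv g) (row_mx v 0).
  by apply: (tangent_curve (curve_pair cg bg)); apply: filterS bE => t /esym.
have TL : tangent (setX_arrows L L') (g, inv g) (row_mx v 0).
  by apply: (tangent_curve (curve_pair cg (curve_cst (inv g)))); apply: filterS cL.
have : tangent (setX_arrows L L' `&` @composable R m d G) (g, inv g) (row_mx v 0).
  have gg : @composable R m d G (g, inv g) by rewrite /composable /= grng_inv.
  by rewrite (clean (g, inv g) (conj Lg L'g) gg).
move=> /tangentP[e [eg eZ]].
have [e1 e2] := prod_curve eg; rewrite row_mxKl row_mxKr /= in e1 e2.
have ie2 := curve_map ism e2; rewrite mdiff0 ginvK in ie2.
apply: (curve_unique e1); apply: near_eq_curve ie2.
apply: filterS eZ => t [[L1 L2] e12] /=.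
have : convolution L L' (gmul (e t).1 (e t).2) by exists (e t).
by rewrite LL' => -[l _ /esym /(gmul_unit_inv e12) ->]; rewrite ginvK.
Qed.

Lemma inverse_rng_immersed L L' g : is_inverse L L' -> L g -> immersed_at r L g.
Proof.
move=> inv' Lg v /tangentP[c [cg cL]] dv0.
have [_ _ [_ clean] _ L'L] := inv'.
have L'g : L' (inv g) by apply: (inverse_star_subset inv'); exists g.
have rc := curve_map rsm cg; rewrite dv0 -(gsrc_inv g) in rc.
rewrite -(mdiff0 s (inv g)) in rc.
have [b [bg bE]] := lift_curve (@gsrc_submersion _ _ _ G) rc.
have Tc : tangent (@composable R m d G) (inv g, g) (row_mx 0 v).
  by apply: (tangent_curve (curve_pair bg cg)); apply: filterS bE => t.
have TL : tangent (setX_arrows L' L) (inv g, g) (row_mx 0 v).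
  by apply: (tangent_curve (curve_pair (curve_cst (inv g)) cg)); apply: filterS cL.
have : tangent (setX_arrows L' L `&` @composable R m d G) (inv g, g) (row_mx 0 v).
  have gg : @composable R m d G (inv g, g) by rewrite /composable /= gsrc_inv.
  by rewrite (clean (inv g, g) (conj L'g Lg) gg).
move=> /tangentP[e [eg eZ]].
have [e1 e2] := prod_curve eg; rewrite row_mxKl row_mxKr /= in e1 e2.
have ie1 := curve_map ism e1; rewrite mdiff0 ginvK in ie1.
apply: (curve_unique e2); apply: near_eq_curve ie1.
apply: filterS eZ => t [[L1 L2] e12] /=.
have : convolution L' L (gmul (e t).1 (e t).2) by exists (e t).
by rewrite L'L => -[l _ /esym /(gmul_unit_inv e12) ->].
Qed.

Lemma star_transversal L : submanifold d L ->
  (forall g, L g -> immersed_at s L g) ->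
  transversally_convolable L (star L).
Proof.
move=> sL sI.
(* [t] is the inverse of [s] on [L] near [h]; it is also defined near [s g], because this is the
   same object. *)
have loc g h : L g -> L h -> s g = s h -> exists (U : set G) (Y : set (objects G))
    (t : objects G -> G), [/\ open U, U h & open Y] /\ [/\ Y (s g), t (s g) = h,
      smooth_map_on Y t, forall x, L x -> U x -> Y (s x) /\ t (s x) = x &
      forall y, Y y -> L (t y) /\ s (t y) = y].
  move=> Lg Lh gh.
  have [U [Y [t [[oU Uh oY] [UY Yt ts]]]]] := immersion_inverse ssm sL Lh (sI h Lh).
  have [Yh th] := UY h Lh Uh.
  exists U, Y, t; split; split=> //; rewrite ?gh //.
  by move=> y /Yt[].
have clean : clean_intersection (setX_arrows L (star L)) (@composable R m d G).
  split.
    exists d => -[g k] [[/= Lg [h Lh <-]]]; rewrite /composable /= grng_inv => gh.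
    have [U [Y [t [[oU Uh oY] [Yg tg ts UY Yt]]]]] := loc g h Lg Lh gh.
    have [c [pm cc cg cL]] := sL g Lg.
    (* The charts are shrunk so that [s q.1] stays in [Y] and [inv q.2] in [U]; there the composable
       pairs are exactly the graph of [inv \o (t \o s)] over [L]. *)
    have oY' : open (s @^-1` Y).
      by apply: open_comp => // x _; exact: smooth_map_continuous openT ssm _.
    have oU' : open (inv @^-1` U).
      by apply: open_comp => // x _; exact: smooth_map_continuous openT ism _.
    have [c1 [cc1 c1D c1E]] := restrict_chart cc oY'.
    have [c' [cc' c'D _]] := restrict_chart (chart_at_compatible (inv h)) oU'.
    pose f := inv \o (t \o s).
    have fg : f g = inv h by rewrite /f /= tg.
    have c1g : cdom c1 g by apply/c1D.
    have c'k : cdom c' (f g).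
      by rewrite fg; apply/c'D; split;
        [exact: mem_chart_at|rewrite /preimage /= ginvK].
    have c1L y : cdom c1 y ->
        (L y <-> forall i : 'I_m, (d <= i)%N -> cmap c1 y ord0 i = 0).
      by move=> /c1D[cy _]; rewrite c1E; exact: cL.
    have fp : plot (f \o cinv c1) (cmap c1 g).
      have sp := smooth_map_plot ssm (plot_cinv cc1 (cimg_cmap c1g)).
      apply: (smooth_map_plot ism); apply: (plot_map ts _ sp).
      by apply: (near_comp sp.1); rewrite /= cmapK //; exact: open_nbhs_nbhs.
    have [e [ce eg eD eE]] := graph_slice pm cc1 cc' c1L c1g c'k fp.
    rewrite fg in eg; exists e; split=> //;
      first exact: leq_trans pm (leq_addr _ _).
    move=> q /[dup] qe /eD[/c1D[_ Yq] /c'D[_ Uq] _].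
    rewrite -eE //; split=> [[[Lq [x Lx xq]]]|[Lq qf]].
      rewrite /composable /= -xq grng_inv => sq; split=> //.
      rewrite /preimage /= -xq ginvK in Uq; rewrite /f /= sq.
      by rewrite (UY x Lx Uq).2.
    have [Lt st] := Yt _ Yq; split; first by split=> //; rewrite qf;
      exists (t (s q.1)).
    by rewrite /composable /= qf /f /= grng_inv st.
  move=> [g k] [/= Lg [h Lh <-]]; rewrite /composable /= grng_inv => gh.
  have [U [Y [t [[oU Uh oY] [Yg tg ts UY Yt]]]]] := loc g h Lg Lh gh.
  apply/seteqP; split=> [v tv|v [/tangentP[ab [abc abL]] /tangentP[e [ec eC]]]].
    by split; apply: tangent_subset tv => q [].
  (* The curves [ab] in [L] times [star L] and [e] in the composable pairs share only their velocity
     [v]. The second component of [ab] is replaced by [inv (t (s (ab u).1))], which makes the pair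
     composable. Velocities are compared in the tangent space of [L] at [h]: both candidates have
     the same image under the differential of [s], so by immersivity they agree. *)
  have [a b] := prod_curve abc; have [e1 e2] := prod_curve ec.
  rewrite /= in a b e1 e2.
  have aL : \forall u \near (0 : R), L (ab u).1 by apply: filterS abL => u [].
  have bL : \forall u \near (0 : R), L (inv (ab u).2).
    by apply: filterS abL => u [_ [x Lx <-]]; rewrite ginvK.
  have ib := curve_map ism b; rewrite ginvK in ib.
  set w := mdiff inv (inv h) (rsubmx v) in ib.
  have bE : rsubmx v = mdiff inv h w by have := mdiff_invK (inv h) (rsubmx v);
    rewrite ginvK.
  have dsE : mdiff s g (lsubmx v) = mdiff s h w.
    have re2 := curve_map rsm e2; rewrite bE mdiff_rng_inv in re2.
    have se1 := curve_map ssm e1; rewrite gh -(grng_inv h) in se1.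
    apply: (curve_unique se1); apply: near_eq_curve re2.
    by apply: filterS eC.
  have [ap a0 _] := a.
  have [x tx] : exists x, curve (t \o (s \o (fun u => (ab u).1))) h x.
    have sp := smooth_map_plot ssm ap.
    have tp : plot (t \o (s \o (fun u => (ab u).1))) 0.
      apply: (plot_map ts _ sp); apply: (near_comp sp.1); rewrite /= a0.
      exact: open_nbhs_nbhs.
    by eexists; split; [exact: tp|rewrite /= a0|reflexivity].
  have nY : \forall u \near (0 : R), Y (s (ab u).1).
    apply: (near_comp (smooth_map_plot ssm ap).1); rewrite /= a0.
    exact: open_nbhs_nbhs.
  have xw : x = w.
    apply: (immersed_inj sL Lh (sI h Lh)).
    - by apply: (tangent_curve tx); apply: filterS nY => u /Yt[].
    - exact: tangent_curve ib bL.
    rewrite -dsE; apply: (curve_unique (curve_map ssm tx)).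
    have := curve_map ssm a; rewrite gh; apply: near_eq_curve.
    by apply: filterS nY => u /Yt[_ /= ->].
  rewrite -(hsubmxK v) bE -xw.
  apply: (tangent_curve (curve_pair a (curve_map ism tx))).
  apply: filterS2 aL nY => u La Yu; have [Lt st] := Yt _ Yu.
  by split; [split=> //;
    exists (t (s (ab u).1))|rewrite /composable /= grng_inv st].
split=> // -[g k] [/= Lg [h Lh <-]]; rewrite /composable /= grng_inv => gh.
apply/seteqP; split=> // v _.
(* Vectors tangent to [L] at [g] and at [h] are chosen to match [v] under the differentials of [s]
   at [g] and of [r] at [inv h]. The remainder has both images zero; lifting constant curves makes
   it tangent to the composable pairs. *)
have [v1 tv1 dv1] := immersed_onto (mdiff s g (lsubmx v)) sL Lg (sI g Lg).
have [w tw dw] := immersed_onto (mdiff r (inv h) (rsubmx v)) sL Lh (sI h Lh).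
exists (row_mx v1 (mdiff inv h w)).
  have [c1 [c1g c1L]] := (tangentP _ _ _).1 tv1; have [c2 [c2h c2L]] :=
    (tangentP _ _ _).1 tw.
  apply: (tangent_curve (curve_pair c1g (curve_map ism c2h))).
  by apply: filterS2 c1L c2L => u L1 L2; split=> //; exists (c2 u).
exists (row_mx (lsubmx v - v1) (rsubmx v - mdiff inv h w)); last first.
  by rewrite add_row_mx addrC subrK addrC subrK hsubmxK.
have da0 : mdiff s g (lsubmx v - v1) = 0 by rewrite mdiffB dv1 subrr.
have db0 : mdiff r (inv h) (rsubmx v - mdiff inv h w) = 0.
  by rewrite mdiffB mdiff_rng_inv dw subrr.
have y1 : curve (fun _ : R => s g) (s g) (mdiff s g (lsubmx v - v1)).
  by rewrite da0; exact: curve_cst.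
have y2 : curve (fun _ : R => r (inv h)) (r (inv h))
  (mdiff r (inv h) (rsubmx v - mdiff inv h w)).
  by rewrite db0; exact: curve_cst.
have [c1 [c1g c1E]] := lift_curve (@gsrc_submersion _ _ _ G) y1.
have [c2 [c2h c2E]] := lift_curve (@grng_submersion _ _ _ G) y2.
apply: (tangent_curve (curve_pair c1g c2h)).
by apply: filterS2 c1E c2E => u; rewrite /composable /= => -> ->; rewrite grng_inv.
Qed.

End Inverses.

(** * Equivalence of invertibility with immersivity and injectivity *)

Section Main.
Context {R : realType} {m d : nat} (G : symplectic_groupoid R m d).
Implicit Types L : set G.
Local Notation om := (@sform R m d G).
Local Notation r := (@grng R m d G).
Local Notation s := (@gsrc R m d G).
Local Notation inv := (@ginv R m d G).
Local Notation rsm := (@grng_submersion R m d G).1.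
Local Notation ssm := (@gsrc_submersion R m d G).1.
Local Notation ism := (@ginv_smooth R m d G).

(** The infinitesimal condition through which both equivalences pass: alone it characterizes the
    local statement, and together with injectivity of [r] and [s] on [L] the global one. *)
Definition bi_immersed L :=
  forall g, L g -> immersed_at r L g /\ immersed_at s L g.

(** The equality [m./2 = d] is available only once a point of [L] is given, so it is established
    inside the pointwise definition of a submanifold; for empty [L] the claim is vacuous. *)
Lemma bi_immersed_submanifold L : lagrangian om L -> bi_immersed L ->
  submanifold d L.
Proof.
move=> [sL _] bL g Lg.
have md : m./2 = d.
  apply/eqP; rewrite eqn_leq (immersed_dim sL Lg (bL g Lg).1).
  exact: objects_dim_le (r g).
by have := sL g Lg; rewrite md.
Qed.

(** Inversion exchanges [r] and [s]. *)
Lemma star_bi_immersed L : bi_immersed L -> bi_immersed (star L).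
Proof.
move=> bL _ [g Lg <-].
have back x : star L x -> L (inv x) by move=> [z Lz <-]; rewrite ginvK.
have tb v : tangent (star L) (inv g) v -> tangent L g (mdiff inv (inv g) v).
  by move=> tv; have := tangent_map ism back tv; rewrite ginvK.
have invK v : mdiff inv g (mdiff inv (inv g) v) = v.
  by have := mdiff_invK (inv g) v; rewrite ginvK.
have [rI sI] := bL g Lg; split=> v /tb tv v0; rewrite -(invK v).
  by rewrite (sI _ tv) ?mdiff0 // -mdiff_rng_inv invK.
by rewrite (rI _ tv) ?mdiff0 // -mdiff_src_inv invK.
Qed.

Lemma bi_immersed_transversal L : lagrangian om L -> bi_immersed L ->
  transversally_convolable L (star L) /\ transversally_convolable (star L) L.
Proof.
move=> lL bL; have sL := bi_immersed_submanifold lL bL.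
have bS := star_bi_immersed bL.
have sS := bi_immersed_submanifold (star_lagrangian lL) bS.
split; first by apply: star_transversal => // g /bL[].
(* Transversality in the other order is the same statement for [star L], whose star is [L]. *)
rewrite -{2}(starK L).
by apply: star_transversal => // g /bS[].
Qed.

Lemma star_is_inverse L : lagrangian om L -> bi_immersed L ->
  (forall g h, L g -> L h -> r g = r h -> g = h) ->
  (forall g h, L g -> L h -> s g = s h -> g = h) -> is_inverse L (star L).
Proof.
move=> lL bL r_inj s_inj; have [[cl1 _] [cl2 _]] := bi_immersed_transversal lL bL.
split=> //; first exact: star_lagrangian.
- apply/seteqP; split=> [x [[g k] [[/= Lg [h Lh <-]]]]|_ [g Lg <-]].
    rewrite /composable /= grng_inv => gh <-; rewrite -(s_inj g h) //.
    by exists g => //; rewrite gmulgV.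
  exists (g, inv g); last by rewrite /= gmulgV.
  by split; [split=> //; exists g|rewrite /composable /= grng_inv].
apply/seteqP; split=> [x [[k g] [[/= [h Lh <-] Lg]]]|_ [g Lg <-]].
  rewrite /composable /= gsrc_inv => gh <-; rewrite (r_inj h g) //.
  by exists g => //; rewrite gmulVg.
exists (inv g, g); last by rewrite /= gmulVg.
by split; [split=> //; exists g|rewrite /composable /= gsrc_inv].
Qed.

Lemma invertible_bi_immersed L : invertible L -> bi_immersed L.
Proof.
move=> [L' inv'] g Lg.
by split; [exact: inverse_rng_immersed inv' Lg|exact: inverse_src_immersed inv' Lg].
Qed.

Lemma invertible_is_inverse L : lagrangian om L -> invertible L ->
  is_inverse L (star L).
Proof.
move=> lL iL; have bL := invertible_bi_immersed iL; have [L' inv'] := iL.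
apply: star_is_inverse => // g h; first exact: inverse_rng_inj inv'.
exact: inverse_src_inj inv'.
Qed.

Lemma locally_invertible_bi_immersed L : lagrangian om L ->
  locally_invertible L -> bi_immersed L.
Proof.
move=> [sL _] lL g Lg; have [P [[[sP PL] _ iP] Pg]] := lL g Lg.
have [rI sI] := invertible_bi_immersed iP Pg.
by split=> v /(tangent_sub_eq sP sL PL Pg); [exact: rI|exact: sI].
Qed.

Lemma lagrangian_open L (U : set G) : open U -> lagrangian om L ->
  lagrangian om (L `&` U).
Proof.
move=> oU [sL iL]; split; first exact: submanifold_open.
move=> g [Lg _] v w tv tw.
by apply: iL => //; [apply: tangent_subset tv|apply: tangent_subset tw] => x [].
Qed.

(** Near [g] both [r] and [s] have local left inverses on [L]; cutting [L] by the two corresponding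
    open sets makes both maps injective. *)
Lemma bi_immersed_patch L g : lagrangian om L -> bi_immersed L -> L g ->
  exists P, [/\ invertible_patch L P, is_inverse P (star P) & P g].
Proof.
move=> lL bL Lg; have sL := bi_immersed_submanifold lL bL.
have [U [Y [t [[oU Ug _] [Ut _ _]]]]] := immersion_inverse rsm sL Lg (bL g Lg).1.
have [U' [Y' [t' [[oU' U'g _] [Ut' _ _]]]]] :=
  immersion_inverse ssm sL Lg (bL g Lg).2.
have oUU : open (U `&` U') by exact: openI.
have lP := lagrangian_open oUU lL; pose P := L `&` (U `&` U').
have PL : P `<=` L by move=> x [].
have bP : bi_immersed P.
  by move=> x [Lx _]; have [rI sI] := bL x Lx; split; exact: immersed_subset PL _.
have iP : is_inverse P (star P).
  apply: star_is_inverse => // x y [Lx [Ux U'x]] [Ly [Uy U'y]] xy.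
    by rewrite -(Ut x Lx Ux).2 xy (Ut y Ly Uy).2.
  by rewrite -(Ut' x Lx U'x).2 xy (Ut' y Ly U'y).2.
exists P; split=> //; split=> //; last by exists (star P).
by split=> //; exact: lP.1.
Qed.

Lemma bi_immersed_local_inverse L : lagrangian om L -> bi_immersed L ->
  is_local_inverse L (star L).
Proof.
move=> lL bL; split.
  (* [star L] is itself Lagrangian, so a constant sequence is a countable cover. *)
  exists (fun _ => star L); split=> [_|]; first exact: star_lagrangian.
  by apply/seteqP; split=> x; [exists 0%N|case].
(* Indexing by all patches inverted by their star avoids choosing one at each point of [L]. *)
pose I := {P : set G | invertible_patch L P /\ is_inverse P (star P)}.
exists I, (fun P => sval P), (fun P => star (sval P)).
split=> [[P []] //|[P []] //||].
  apply/seteqP; split=> [g Lg|g [[P [[[_ PL] _ _] _]] _] /= Pg]; last exact: PL.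
  by have [P [pP iP Pg]] := bi_immersed_patch lL bL Lg;
    exists (exist _ P (conj pP iP)).
apply/seteqP; split=> [_ [g Lg <-]|_ [[P [[[_ PL] _ _] _]] _] /= [g Pg <-]].
  have [P [pP iP Pg]] := bi_immersed_patch lL bL Lg.
  by exists (exist _ P (conj pP iP)) => //; exists g.
by exists g => //; exact: PL.
Qed.

End Main.

Theorem theorem11 (R : realType) (m d : nat) (G : symplectic_groupoid R m d)
    (L : set G) (hL : lagrangian (@sform R m d G) L) :
  [/\ (locally_invertible L <->
         local_diffeo (@grng R m d G) L /\ local_diffeo (@gsrc R m d G) L),
      (invertible L <->
         diffeo_onto_range (@grng R m d G) L /\
         diffeo_onto_range (@gsrc R m d G) L),
      (locally_invertible L ->
         [/\ transversally_convolable L (star L),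
             transversally_convolable (star L) L &
             is_local_inverse L (star L)]) &
      (invertible L ->
         [/\ transversally_convolable L (star L),
             transversally_convolable (star L) L &
             is_inverse L (star L)])].
Proof.
have [rsm ssm] := ((@grng_submersion _ _ _ G).1, (@gsrc_submersion _ _ _ G).1).
split.
- split=> [/(locally_invertible_bi_immersed hL) bL|[rL sL]].
    have smL := bi_immersed_submanifold hL bL.
    by split; apply: immersion_local_diffeo => // g /bL[].
  have bL : bi_immersed L.
    move=> g Lg; split; [exact: local_diffeo_immersed rL Lg|].
    exact: local_diffeo_immersed sL Lg.
  by move=> g /(bi_immersed_patch hL bL)[P [pP _ Pg]]; exists P.
- split=> [iL|[rL sL]].
    have bL := invertible_bi_immersed iL; have [L' inv'] := iL.
    have smL := bi_immersed_submanifold hL bL.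
    split.
      apply: (immersion_diffeo rsm smL _ _).2 => [g /bL[] //|g h].
      exact: inverse_rng_inj inv'.
    apply: (immersion_diffeo ssm smL _ _).2 => [g /bL[] //|g h].
    exact: inverse_src_inj inv'.
  exists (star L); apply: star_is_inverse => //.
  + move=> g Lg; split; [exact: diffeo_immersed rL Lg|].
    exact: diffeo_immersed sL Lg.
  + by have [_ r_inj _ _] := rL.
  by have [_ s_inj _ _] := sL.
- move=> /(locally_invertible_bi_immersed hL) bL.
  have [t1 t2] := bi_immersed_transversal hL bL.
  by split=> //; exact: bi_immersed_local_inverse.
move=> iL; have [t1 t2] := bi_immersed_transversal hL (invertible_bi_immersed iL).
by split=> //; exact: invertible_is_inverse.
Qed.
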